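(* Let $a,b,c,d\in\mathbb{Z}$, not all zero, let $\lambda\in\{1,2\}$ and $m\in\{2,3\}$, and put $N=a^2+b^2+c^2+d^2$. Then every $n\in\mathbb{N}$ can be written as $n=x^2+y^2+z^2+w^2$ with rational numbers $x,y,z,w$ satisfying $Nx,Ny,Nz,Nw\in\mathbb{Z}$, such that $ax+by+cz+dw=\lambda r^m$ for some $r\in\mathbb{N}$.
   Context: $\mathbb{N}=\{0,1,2,\ldots\}$. *)

(* Defs.v *)
From mathcomp Require Export all_boot all_order all_algebra.

(* Main.v *)
Require Import Defs.
From mathcomp Require Import all_boot all_order all_algebra.
From mathcomp Require Import all_fingroup all_solvable all_field.
From mathcomp Require Import ring zify.
Import Order.TTheory GRing.Theory Num.Theory.
Local Open Scope ring_scope.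
Set Implicit Arguments.
Unset Strict Implicit.
Unset Printing Implicit Defensive.

(** Multiplication by the quaternion [a + b i + c j + d k] reduces the theorem to
    writing [N * n] as [(lambda * r ^ m) ^ 2] plus three integer squares, which
    follows from the three-square theorem and a discussion of powers of 4.

    The three-square theorem is proved without primes in arithmetic progressions.
    If [n] divides [m * al ^ 2 + 1] and [m] divides [n * be ^ 2 + 1], then [n] is
    represented by an integral ternary form of determinant 1, hence by a sum of
    three squares.  To find [m], let [chi] be the quadratic character attached to
    [- n], of modulus [Q], and let [rho] be the convolution of [chi] with 1.  For
    [chi a = 1] the sums of [rho] over the integers up to [X] congruent to [a] and to
    [1] modulo [Q] differ by [O(sqrt X)] (hyperbola method), whereas the second one
    is not [O(sqrt X)] because [rho] is positive on the values of [x ^ 2 + n * y ^ 2].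
    So [rho] is positive at some [M] congruent to [a]; then [M = m * k ^ 2] with
    [- n] a square modulo [m]. *)

(** * Unimodular ternary forms *)

Definition dot (u v : int * int * int) : int :=
  u.1.1 * v.1.1 + u.1.2 * v.1.2 + u.2 * v.2.

(** Gram matrices of triples in [int] cubed. The entries [d], [e], [f] sit off the diagonal,
    opposite to [a], [b], [c]: at places (2,3), (1,3) and (1,2). *)
Definition is_gram (a b c d e f : int) : Prop :=
  exists u v w : int * int * int,
    [/\ dot u u = a, dot v v = b & dot w w = c] /\
    [/\ dot v w = d, dot u w = e & dot u v = f].

Lemma is_gram_swap12 a b c d e f : is_gram b a c e d f -> is_gram a b c d e f.
Proof.
case=> u [v [w [[ha hb hc] [hd he hf]]]]; exists v, u, w; split; split=> //.
by rewrite -hf /dot; ring.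
Qed.

Lemma is_gram_swap23 a b c d e f : is_gram a c b d f e -> is_gram a b c d e f.
Proof.
case=> u [v [w [[ha hb hc] [hd he hf]]]]; exists u, w, v; split; split=> //.
by rewrite -hd /dot; ring.
Qed.

(** The hypothesis is the Gram matrix after the base change [v := v + k u]; subtracting [k u] undoes
    it. *)
Lemma is_gram_shear12 k a b c d e f :
  is_gram a (b + 2 * k * f + k ^+ 2 * a) c (d + k * e) e (f + k * a) ->
  is_gram a b c d e f.
Proof.
case=> u [v [w [[ha hb hc] [hd he hf]]]].
exists u, (v.1.1 - k * u.1.1, v.1.2 - k * u.1.2, v.2 - k * u.2), w.
move: ha hb hc hd he hf; rewrite /dot /= => ha hb hc hd he hf.
split; split=> //.
- have -> : b = (b + 2 * k * f + k ^+ 2 * a) - 2 * k * (f + k * a) + k ^+ 2 * a by ring.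
  by rewrite -hb -hf -ha; ring.
- have -> : d = (d + k * e) - k * e by ring.
  by rewrite -hd -he; ring.
- have -> : f = (f + k * a) - k * a by ring.
  by rewrite -hf -ha; ring.
Qed.

Lemma is_gram_shear13 k a b c d e f :
  is_gram a b (c + 2 * k * e + k ^+ 2 * a) (d + k * f) (e + k * a) f ->
  is_gram a b c d e f.
Proof. by move=> h; apply/is_gram_swap23/(is_gram_shear12 (k := k))/is_gram_swap23. Qed.

Lemma is_gram_shear23 k a b c d e f :
  is_gram a b (c + 2 * k * d + k ^+ 2 * b) (d + k * b) (e + k * f) f ->
  is_gram a b c d e f.
Proof. by move=> h; apply/is_gram_swap12/(is_gram_shear13 (k := k))/is_gram_swap12. Qed.

Lemma centered_rem (a b : int) : 0 < a ->
  exists k : int, (- a <= 2 * (b + k * a)) && (2 * (b + k * a) <= a).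
Proof.
move=> a0; exists (- ((2 * b + a) %/ (2 * a))%Z).
have h2a : 0 < 2 * a by lia.
have := divz_eq (2 * b + a) (2 * a).
have := ltz_pmod (2 * b + a) h2a; have := modz_ge0 (2 * b + a) (lt0r_neq0 h2a).
set k := divz _ _; set r := modz _ _ => h1 h2 h3; apply/andP; nia.
Qed.

(** Gauss reduction. Once [2 * |d| <= b], the equation [b * c = 1 + d ^ 2] forces [c < b] unless
    [b = 1], so exchanging the last two vectors lowers [b]. *)
Lemma unimodular_binary (N : nat) (b c d : int) :
  0 < b -> b <= N%:Z -> b * c - d ^+ 2 = 1 -> is_gram 1 b c d 0 0.
Proof.
elim: N b c d => [|N IH] b c d b0 bN; first by lia.
move=> det1; have [k hk] := centered_rem d b0; apply: (is_gram_shear23 (k := k)).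
set d' := d + k * b in hk *; set c' := c + _ + _; rewrite mulr0 addr0.
have det' : b * c' - d' ^+ 2 = 1 by rewrite -[RHS]det1 /c' /d'; ring.
have [b1|b1] := eqVneq b 1.
  exists (1, 0, 0), (0, 1, 0), (0, d', 1); rewrite /dot /=.
  by split; split; move: det'; rewrite b1; lia.
apply: is_gram_swap23; apply: IH; last by rewrite -[RHS]det'; ring.
  by nia.
suff : c' < b by lia.
have : b * c' < b * b by nia.
by rewrite ltr_pM2l.
Qed.

(* The measure is lexicographic: the leading entry [a], then the leading entry
   [a * b - f ^+ 2] of the form induced on the quotient by the first vector. *)
Theorem unimodular_ternary (N1 N2 : nat) (a b c d e f : int) :
  0 < a -> a <= N1%:Z -> 0 < a * b - f ^+ 2 -> a * b - f ^+ 2 <= N2%:Z ->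
  a * b * c + 2 * d * e * f - a * d ^+ 2 - b * e ^+ 2 - c * f ^+ 2 = 1 ->
  is_gram a b c d e f.
Proof.
elim: N1 N2 a b c d e f => [|N1 IH1]; first by lia.
elim=> [|N2 IH2] a b c d e f a0 aN A0 AN det1; first by lia.
have [a1|a1] := eqVneq a 1.
  (* A first vector of norm 1 splits off: the two shears make [f] and [e] vanish and leave a binary
     form of determinant 1. *)
  apply: (is_gram_shear12 (k := - f)); apply: (is_gram_shear13 (k := - e)).
  move: A0 det1; rewrite a1 !mulr1 !subrr mulr0 addr0 => A0 det1.
  have A0' : 0 < b + 2 * - f * f + (- f) ^+ 2.
    by move: A0; rewrite (_ : 1 * b - _ = b + 2 * - f * f + (- f) ^+ 2) //; ring.
  apply: (@unimodular_binary (absz (b + 2 * - f * f + (- f) ^+ 2))) => //.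
    by rewrite gez0_abs // ltW.
  by rewrite -[RHS]det1; ring.
(* [a * d - e * f] is the off-diagonal entry of the form induced on the quotient. That form, with
   entries [A], [B], [C] below, has determinant [a]. *)
have [k hk] := centered_rem (a * d - e * f) A0.
apply: (is_gram_shear23 (k := k)).
set c' := c + _ + _; set d' := d + _; set e' := e + _.
have det' : a * b * c' + 2 * d' * e' * f - a * d' ^+ 2 - b * e' ^+ 2 - c' * f ^+ 2 = 1.
  by rewrite -[RHS]det1 /c' /d' /e'; ring.
have hB : a * d - e * f + k * (a * b - f ^+ 2) = a * d' - e' * f by rewrite /d' /e'; ring.
rewrite hB in hk; clearbody c' d' e'; clear c d e k det1 hB.
pose A := a * b - f ^+ 2; pose B := a * d' - e' * f; pose C := a * c' - e' ^+ 2.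
have detH : A * C - B ^+ 2 = a by rewrite -[RHS]mulr1 -det' /A /B /C; ring.
(* If [4 * a < 3 * A ^ 2], then [A * C = a + B ^ 2 < A ^ 2], and exchanging the last two vectors
   replaces [A] by the smaller [C] while keeping [a]. *)
have [hA|hA] := leP (3 * A ^+ 2) (4 * a); last first.
  rewrite -/A -/B in A0 hk.
  have detH' : A * C = a + B ^+ 2 by rewrite -detH; ring.
  have C0 : 0 < C by rewrite -(pmulr_rgt0 _ A0) detH' ltr_wpDr ?sqr_ge0.
  have CA : C < A.
    rewrite -(ltr_pM2l A0) detH'.
    have : 0 <= (A - 2 * B) * (A + 2 * B) by apply: mulr_ge0; lia.
    have -> : (A - 2 * B) * (A + 2 * B) = A ^+ 2 - 4 * B ^+ 2 by ring.
    by move: hA hk; clear; lia.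
  apply: is_gram_swap23; apply: IH2 => //.
    by rewrite -/C; rewrite -/A in AN; lia.
  by rewrite -[RHS]det'; ring.
have [j hj] := centered_rem f a0.
apply: (is_gram_shear12 (k := j)).
set b' := b + _ + _; set d'' := d' + _; set f' := f + _.
have det'' : a * b' * c' + 2 * d'' * e' * f' - a * d'' ^+ 2 - b' * e' ^+ 2 - c' * f' ^+ 2 = 1.
  by rewrite -[RHS]det' /b' /d'' /f'; ring.
have hA' : A = a * b' - f' ^+ 2 by rewrite /A /b' /f'; ring.
rewrite -/f' in hj; clearbody b' d'' f'; rewrite -/A in A0.
have hab : a * b' = A + f' ^+ 2 by rewrite hA'; ring.
have b0 : 0 < b' by rewrite -(pmulr_rgt0 _ a0) hab ltr_wpDr ?sqr_ge0.
(* Otherwise [27 * a ^ 3 <= 64], against [a >= 2]. With [2 * |f'| <= a] this gives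
   [a * b' = A + f' ^ 2 < a ^ 2], so exchanging the first two vectors lowers [a]. *)
have A_small : 4 * A < 3 * a ^+ 2.
  rewrite ltNge; apply/negP => hle.
  have h1 : (3 * a ^+ 2) * (3 * a ^+ 2) <= (4 * A) * (4 * A).
    by apply: ler_pM => //; rewrite mulr_ge0 ?sqr_ge0.
  have a_ge2 : 2 <= a by lia.
  have h2 : 2 ^+ 3 <= a ^+ 3 by rewrite lerXn2r ?nnegrE // ltW.
  have h3 : a * 27 * 2 ^+ 3 <= a * 27 * a ^+ 3 by rewrite ler_wpM2l // mulr_ge0 // ltW.
  have e1 : (3 * a ^+ 2) * (3 * a ^+ 2) * 3 = a * 27 * a ^+ 3 by ring.
  have e2 : (4 * A) * (4 * A) * 3 = 16 * (3 * A ^+ 2) by ring.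
  by move: a0 hA h1 h3 e1 e2; clear; lia.
have ba : b' < a.
  rewrite -(ltr_pM2l a0) hab.
  have : 0 <= (a - 2 * f') * (a + 2 * f') by apply: mulr_ge0; lia.
  have -> : (a - 2 * f') * (a + 2 * f') = a ^+ 2 - 4 * f' ^+ 2 by ring.
  by move: A_small; clear; lia.
apply: is_gram_swap12; apply: (IH1 (absz A)) => //.
- by lia.
- by rewrite mulrC -hA'.
- by rewrite mulrC -hA' gez0_abs // ltW.
- by rewrite -[RHS]det''; ring.
Qed.

(* The unimodular form used here is [(X ^ 2 + m * Y ^ 2 + n * Z ^ 2) / (m * n)]
   restricted to the lattice [X = m * al * Y] modulo [n], [X = n * be * Z] modulo [m]. *)
Lemma three_squares_of_residues (n m al be : int) :
  0 < n -> 0 < m -> (n %| m * al ^+ 2 + 1)%Z -> (m %| n * be ^+ 2 + 1)%Z ->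
  exists x y z : int, n = x ^+ 2 + y ^+ 2 + z ^+ 2.
Proof.
move=> n0 m0 /dvdzP[A hA] /dvdzP[B hB].
have A0 : 0 < A by nia.
have B0 : 0 < B by nia.
have mn0 : 0 < m * n by nia.
have hAB : m * n * (A * B - (al * be) ^+ 2) = m * al ^+ 2 + n * be ^+ 2 + 1.
  have -> : m * n * (A * B - (al * be) ^+ 2)
    = (A * n) * (B * m) - (m * al ^+ 2) * (n * be ^+ 2) by ring.
  by rewrite -hA -hB; ring.
have minor0 : 0 < A * B - (al * be) ^+ 2 by rewrite -(pmulr_rgt0 _ mn0) hAB; nia.
have [|||u [v [w [[hu _ hw] [_ huw _]]]]] := @unimodular_ternary (absz A)
    (absz (A * B - (al * be) ^+ 2)%R) A B (m * n) (n * be) (m * al) (al * be) A0 _ minor0.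
- by rewrite gez0_abs // ltW.
- by rewrite gez0_abs // ltW.
- have -> : A * B * (m * n) + 2 * (n * be) * (m * al) * (al * be) - A * (n * be) ^+ 2
    - B * (m * al) ^+ 2 - m * n * (al * be) ^+ 2
    = (A * n) * (B * m) + (m * al ^+ 2) * (n * be ^+ 2) - (A * n) * (n * be ^+ 2)
      - (B * m) * (m * al ^+ 2) by ring.
  by rewrite -hA -hB; ring.
(* The vector [n u - al w] has norm [n * (m * al ^ 2 + 1) - 2 * n * m * al ^ 2 + m * n * al ^ 2 =
   n]. *)
exists (n * u.1.1 - al * w.1.1), (n * u.1.2 - al * w.1.2), (n * u.2 - al * w.2).
transitivity (n ^+ 2 * dot u u - 2 * n * al * dot u w + al ^+ 2 * dot w w).
  rewrite hu huw hw.
  have -> : n ^+ 2 * A = n * (A * n) by ring.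
  by rewrite -hA; ring.
by rewrite /dot; ring.
Qed.

(** * Quadratic reciprocity *)

Definition ternary_valued (x : int) : Prop := [\/ x = 0, x = 1 | x = -1].

Lemma finField_prim_root (K : finFieldType) :
  exists z : K, (#|K|.-1).-primitive_root z.
Proof.
pose rs := enum (predC1 (0 : K)).
have K_gt1 : (1 < #|K|)%N by exact: finRing_gt1.
have szrs : size rs = #|K|.-1 by rewrite -cardE cardC1.
have [||||z _ prim_z] := hasP (@has_prim_root K #|K|.-1 rs _ _ _ _).
- by lia.
- apply/allP => x; rewrite mem_enum => x0; apply/unity_rootP.
  by apply: (mulfI x0); rewrite -exprS mulr1 prednK ?expf_card // ltnW.
- exact: enum_uniq.
- by rewrite szrs.
by exists z.
Qed.

(** In the field with [p ^ totient N] elements the multiplicative group is cyclic, and by Euler's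
    theorem [N] divides its order. *)
Lemma prim_root_coprime_char (p N : nat) : prime p -> (0 < N)%N -> coprime p N ->
  exists (F : finFieldType) (z : F), p \in [pchar F] /\ N.-primitive_root z.
Proof.
move=> p_pr N_gt0 pN; have k_gt0 : (0 < totient N)%N by rewrite totient_gt0.
have [F chF cardF] := pPrimePowerField p_pr k_gt0.
have [z prim_z] := finField_prim_root F.
have dvdN : (N %| #|F|.-1)%N.
  rewrite cardF -subn1 -eqn_mod_dvd ?expn_gt0 ?prime_gt0 //.
  by apply/eqP/Euler_exp_totient.
by exists F, (z ^+ (#|F|.-1 %/ N)); split=> //; apply: dvdn_prim_root.
Qed.

(** * The quadratic character of a finite field of odd order *)

Section QuadraticCharacter.
Variable K : finFieldType.
Hypothesis oddK : odd #|K|.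

(** Defined through Euler's criterion, which makes multiplicativity immediate; the description by
    squares is [qchar_eq1P]. *)
Definition qchar (x : K) : int :=
  if x == 0 then 0 else if x ^+ (#|K|.-1)./2 == 1 then 1 else -1.

Let h := (#|K|.-1)./2.

Lemma half_card_gt0 : (0 < h)%N.
Proof.
by rewrite /h; move: #|K| oddK (finRing_gt1 K : (1 < #|K|)%N) => n; lia.
Qed.

Lemma half_cardE : #|K|.-1 = (h * 2)%N.
Proof.
by rewrite /h; move: #|K| oddK (finRing_gt1 K : (1 < #|K|)%N) => n; lia.
Qed.

(** If 2 vanished, a generator [z] would satisfy [(z ^ h - 1) ^ 2 = 0], hence [z ^ h = 1], although
    its order is [2 * h]. *)
Lemma two_neq0 : (2%:R : K) != 0.
Proof.
have [z prim_z] := finField_prim_root K; apply/eqP => two0.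
have zh : (z ^+ h - 1) ^+ 2 = 0.
  have -> : (z ^+ h - 1) ^+ 2 = z ^+ h ^+ 2 + 1 - 2%:R * z ^+ h by ring.
  rewrite -exprM -half_cardE (prim_expr_order prim_z) two0 mul0r subr0.
  exact: two0.
move/eqP: zh; rewrite sqrf_eq0 subr_eq0 -(prim_order_dvd prim_z) half_cardE.
by rewrite gtnNdvd ?half_card_gt0 // ltn_Pmulr ?half_card_gt0.
Qed.

Lemma qchar0 : qchar 0 = 0. Proof. by rewrite /qchar eqxx. Qed.

Lemma qchar1 : qchar 1 = 1.
Proof. by rewrite /qchar oner_eq0 expr1n eqxx. Qed.

Lemma expf_card1 (x : K) : x != 0 -> x ^+ #|K|.-1 = 1.
Proof.
move=> x0; apply: (mulfI x0); rewrite -exprS mulr1 prednK ?expf_card //.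
exact: ltnW (finRing_gt1 K).
Qed.

Lemma qcharE (x : K) : (qchar x)%:~R = x ^+ h.
Proof.
rewrite /qchar; have [->|x0] := eqVneq; first by rewrite expr0n eqn0Ngt half_card_gt0.
rewrite -/h; have [->//|xh] := eqVneq.
have : (x ^+ h) ^+ 2 == 1 by rewrite -exprM -half_cardE expf_card1.
by rewrite sqrf_eq1 (negPf xh) /= => /eqP->; rewrite rmorphN1.
Qed.

Lemma qchar_eq0 x : (qchar x == 0) = (x == 0).
Proof. by rewrite /qchar; case: ifP => // _; case: ifP. Qed.

Lemma qchar_cases x : ternary_valued (qchar x).
Proof.
rewrite /qchar; case: ifP => _; first by constructor 1.
by case: ifP => _; [constructor 2 | constructor 3].
Qed.

(** Lets identities between character values be checked in any field where 2 is nonzero, in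
    particular where Euler's criterion is available. *)
Lemma sign_inj (R : fieldType) (a b : int) : (2%:R : R) != 0 ->
  ternary_valued a -> ternary_valued b ->
  a%:~R = b%:~R :> R -> a = b.
Proof.
move=> two0; have one0 := oner_neq0 R.
have N11 : (1 : R) != -1 by rewrite -subr_eq0 opprK.
by case=> ->; case=> -> //=; rewrite ?rmorphN1 ?rmorph1 ?rmorph0 => /eqP;
  rewrite 1?eq_sym ?oppr_eq0 ?(negPf one0) ?(negPf N11) // eq_sym
    ?oppr_eq0 ?(negPf one0) ?(negPf N11).
Qed.

Lemma qcharM x y : qchar (x * y) = qchar x * qchar y.
Proof.
apply: (sign_inj two_neq0); [exact: qchar_cases| |].
  by case: (qchar_cases x) => ->; case: (qchar_cases y) => ->;
    rewrite ?mul0r ?mulr0 ?mul1r ?mulr1 ?mulrNN ?mulr1; constructor.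
by rewrite rmorphM /= !qcharE exprMn.
Qed.

Lemma qchar_sqr x : x != 0 -> qchar x ^+ 2 = 1.
Proof.
by move=> x0; have := qchar_cases x; have := qchar_eq0 x; rewrite (negPf x0);
  case: (qchar_cases x) => ->.
Qed.

(** For a generator [z], the power [z ^ (i * h)] is 1 only if [2 * h] divides [i * h], that is, only
    if [i] is even. *)
Lemma qchar_eq1P x : reflect (exists2 y, y != 0 & x = y ^+ 2) (qchar x == 1).
Proof.
apply: (iffP eqP) => [x1|[y y0 ->]]; last by rewrite expr2 qcharM -expr2 qchar_sqr.
have [z prim_z] := finField_prim_root K.
have x0 : x != 0 by rewrite -qchar_eq0 x1.
have [[i ltiK] /= xE] := prim_rootP prim_z (expf_card1 x0).
have : x ^+ h = 1 by rewrite -qcharE x1.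
rewrite xE -exprM => /eqP; rewrite -(prim_order_dvd prim_z) half_cardE mulnC.
rewrite dvdn_pmul2r ?half_card_gt0 // => /dvdnP[j ij].
exists (z ^+ j); last by rewrite -exprM -ij.
by apply: contra_neq x0 => zj; rewrite xE ij exprM zj expr0n.
Qed.

Lemma qchar_nonresidue : exists x, qchar x = -1.
Proof.
have [z prim_z] := finField_prim_root K; exists z.
rewrite /qchar; have [z0|z0] := eqVneq.
  have := prim_expr_order prim_z; rewrite z0 expr0n half_cardE muln_eq0 orbF.
  by rewrite eqn0Ngt half_card_gt0 => /eqP; rewrite eq_sym oner_eq0.
rewrite -/h -(prim_order_dvd prim_z) half_cardE gtnNdvd ?half_card_gt0 //.
by rewrite ltn_Pmulr ?half_card_gt0.
Qed.

Lemma sum_qchar : \sum_x qchar x = 0.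
Proof.
have [g gN] := qchar_nonresidue.
have g0 : g != 0 by rewrite -qchar_eq0 gN.
have : \sum_x qchar x = - \sum_x qchar x.
  rewrite {1}(reindex (fun x => g * x)) /=; last first.
    by exists (fun x => g^-1 * x) => x _; rewrite ?mulKf ?mulVKf.
  by rewrite -sumrN; apply: eq_bigr => x _; rewrite qcharM gN mulN1r.
by lia.
Qed.

End QuadraticCharacter.

(** * Additive characters and Gauss sums *)

Section AdditiveCharacter.
Variables (q : nat) (q_pr : prime q) (F : fieldType) (z : F).
Hypothesis prim_z : q.-primitive_root z.

Definition zchar (a : 'F_q) : F := z ^+ (a : nat).

Lemma zchar_nat (m : nat) : zchar m%:R = z ^+ m.
Proof. by rewrite /zchar val_Fp_nat // (prim_expr_mod prim_z). Qed.

Lemma zcharD a b : zchar (a + b) = zchar a * zchar b.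
Proof.
by rewrite -[a in LHS]natr_Zp -[b in LHS]natr_Zp -natrD zchar_nat exprD.
Qed.

Lemma zcharMn a m : zchar (a *+ m) = zchar a ^+ m.
Proof. by rewrite -[a in LHS]natr_Zp -mulrnA zchar_nat exprM. Qed.

Lemma zchar0 : zchar 0 = 1.
Proof. by rewrite /zchar expr0. Qed.

Lemma zchar_eq1 a : (zchar a == 1) = (a == 0).
Proof.
rewrite /zchar -(prim_order_dvd prim_z); apply/idP/eqP => [|->]; last exact: dvdn0.
move=> qa; apply/val_inj => /=; apply/eqP.
case: posnP qa => // a0 /(dvdn_leq a0) qa.
by have := ltn_ord a; rewrite [X in (_ < X)%N]Fp_cast // ltnNge qa.
Qed.

Lemma sum_zchar b : \sum_a zchar (a * b) = if b == 0 then q%:R else 0.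
Proof.
have [->|b0] := eqVneq b 0.
  under eq_bigr do rewrite mulr0 zchar0.
  by rewrite sumr_const card_Fp.
have : \sum_a zchar (a * b) = zchar b * \sum_a zchar (a * b).
  rewrite {1}(reindex (fun a => a + 1)) /=; last first.
    by exists (fun a => a - 1) => a _; rewrite ?addrK ?subrK.
  rewrite mulr_sumr; apply: eq_bigr => a _.
  by rewrite mulrDl mul1r zcharD mulrC.
move/eqP; rewrite -subr_eq0 -{1}[\sum_a _]mul1r -mulrBl mulf_eq0 subr_eq0.
by rewrite eq_sym zchar_eq1 (negPf b0) => /eqP.
Qed.

End AdditiveCharacter.

Lemma odd_prime_card (q : nat) : prime q -> odd q -> odd #|'F_q|.
Proof. by move=> q_pr; rewrite card_Fp. Qed.

Definition legendre (x : int) (p : nat) : int := qchar (x%:~R : 'F_p).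

Section GaussSum.
Variables (p q : nat) (p_pr : prime p) (q_pr : prime q).
Hypotheses (p_odd : odd p) (q_odd : odd q) (pq : p != q).
Variables (F : fieldType) (z : F).
Hypothesis chF : p \in [pchar F].
Hypothesis prim_z : q.-primitive_root z.

Let oddq := odd_prime_card q_pr q_odd.

Definition gauss_sum : F := \sum_(a : 'F_q) (qchar a)%:~R * zchar z a.

Lemma gauss_sum_sqr : gauss_sum ^+ 2 = (legendre (-1) q * q%:Z)%:~R.
Proof.
rewrite expr2 {1}/gauss_sum mulr_suml.
(* The second summation variable is written [a * c], which is a bijection only for nonzero [a]; the
   factor [qchar a] then occurs squared. *)
transitivity (\sum_(a : 'F_q) \sum_(c : 'F_q)
    (if a == 0 then 0 else (qchar c)%:~R * zchar z (a * (1 + c)))).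
  apply: eq_bigr => a _; have [->|a0] := eqVneq a 0.
    by rewrite qchar0 !mul0r big1.
  rewrite /gauss_sum mulr_sumr (reindex (fun c => a * c)) /=; last first.
    by exists (fun c => a^-1 * c) => c _; rewrite ?mulKf ?mulVKf.
  apply: eq_bigr => c _; rewrite qcharM // mulrDr mulr1 zcharD //.
  have qa2 : (qchar a)%:~R ^+ 2 = 1 :> F by rewrite -rmorphXn /= qchar_sqr.
  transitivity ((qchar a)%:~R ^+ 2 * ((qchar c)%:~R * (zchar z a * zchar z (a * c))));
    last by rewrite qa2 mul1r.
  by rewrite rmorphM /=; ring.
rewrite exchange_big /=.
(* The sum over nonzero [a] is a full character sum minus its term 1 at [a = 0], and the full sum
   vanishes unless [c = -1]. *)
transitivity (\sum_(c : 'F_q) (qchar c)%:~R * ((if c == -1 then q%:R else 0) - 1 : F)).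
  apply: eq_bigr => c _.
  have -> : (c == -1) = (1 + c == 0) by rewrite addrC addr_eq0.
  rewrite -(sum_zchar q_pr prim_z) [X in _ * (X - 1)](bigD1 0) //= mul0r zchar0 addrAC subrr add0r.
  rewrite mulr_sumr [LHS](bigD1 0) //= add0r.
  by apply: eq_bigr => a /negPf->.
under eq_bigr do rewrite mulrBr mulr1.
rewrite sumrB -[X in _ - X]rmorph_sum /= sum_qchar // rmorph0 subr0.
rewrite (bigD1 (-1)) //= eqxx big1 ?addr0.
  by rewrite rmorphM /= /legendre rmorphN1.
by move=> c /negPf->; rewrite mulr0.
Qed.

(** The Frobenius map turns [zchar z a] into [zchar z (a * p)] and fixes the values of [qchar]
    because [p] is odd; it remains to reindex by [a * p]. *)
Lemma gauss_sum_frob : gauss_sum ^+ p = (legendre p q)%:~R * gauss_sum.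
Proof.
have pF0 : (p%:R : 'F_q) != 0.
  by rewrite -(dvdn_pcharf (pchar_Fp q_pr)) dvdn_prime2 // eq_sym.
rewrite -(pFrobenius_autE chF) /gauss_sum rmorph_sum /= mulr_sumr.
rewrite [RHS](reindex (fun a => a * p%:R)) /=; last first.
  by exists (fun a => a / p%:R) => a _; rewrite ?mulfK ?mulfVK.
apply: eq_bigr => a _; rewrite pFrobenius_autE exprMn -zcharMn // -[a *+ p]mulr_natr.
rewrite mulrA; congr (_ * _).
have -> : legendre p q = qchar (p%:R : 'F_q) by rewrite /legendre -pmulrn.
rewrite qcharM // -rmorphM /= mulrCA -expr2 qchar_sqr // mulr1.
rewrite -rmorphXn /=; congr (_%:~R); have p0 := prime_gt0 p_pr.
case: (qchar_cases a) => ->; rewrite ?expr0n ?eqn0Ngt ?p0 ?expr1n //.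
by rewrite -signr_odd p_odd.
Qed.

End GaussSum.

(** Cancelling [tau] gives [s = tau ^ (p - 1) = D ^ ((p - 1) / 2)], which is Euler's criterion. It
    serves both for reciprocity and for the symbol of 2. *)
Lemma gauss_sum_euler (F : fieldType) (p : nat) (tau : F) (D s : int) :
  prime p -> odd p -> p \in [pchar F] -> ternary_valued s ->
  tau ^+ 2 = D%:~R -> tau ^+ p = s%:~R * tau -> ~~ (p %| D)%Z -> legendre D p = s.
Proof.
move=> p_pr p_odd chF sP tau2 taup pD.
have D0 : (D%:~R : F) != 0 by rewrite -(dvdz_pcharf chF).
have tau0 : tau != 0 by apply: contra_neq D0; rewrite -tau2 => ->; rewrite expr0n.
have two0 : (2%:R : F) != 0.
  by rewrite -(dvdn_pcharf chF) dvdn_prime2 //; apply: contraL p_odd => /eqP->.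
apply: (sign_inj two0) => //; first exact: qchar_cases.
transitivity (D%:~R ^+ p.-1./2 : F); last first.
  apply: (mulIf tau0); rewrite -taup -tau2 -exprM -exprSr; congr (_ ^+ _).
  by have := prime_gt1 p_pr; lia.
(* Both [F] and ['F_p] have characteristic [p], so an equality between images of integers can be
   moved from one to the other. *)
apply/eqP; rewrite -subr_eq0 -rmorphXn -rmorphB /= -(dvdz_pcharf chF).
rewrite (dvdz_pcharf (pchar_Fp p_pr)) rmorphB rmorphXn subr_eq0 /=.
by rewrite /legendre qcharE ?card_Fp.
Qed.

Lemma quadratic_reciprocity (p q : nat) : prime p -> prime q -> odd p -> odd q ->
  p != q -> legendre (legendre (-1) q * q%:Z) p = legendre p q.
Proof.
move=> p_pr q_pr p_odd q_odd pq.
have [|F [z [chF prim_z]]] := @prim_root_coprime_char p q p_pr (prime_gt0 q_pr).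
  by rewrite prime_coprime // dvdn_prime2.
apply: (@gauss_sum_euler F p (gauss_sum q z)) => //; first exact: qchar_cases.
- exact: gauss_sum_sqr.
- exact: gauss_sum_frob.
have : (-1 : 'F_q) != 0 by rewrite oppr_eq0 oner_neq0.
rewrite -(qchar_eq0 (-1)) /legendre rmorphN1 /=; case: (qchar_cases (-1 : 'F_q)) => -> // _.
  by rewrite mul1r dvdzE dvdn_prime2.
by rewrite mulN1r dvdzE abszN dvdn_prime2.
Qed.

Lemma coprimen8 m : coprime m 8 = odd m.
Proof. by rewrite -coprimen2 -[RHS](@coprime_pexpr 3). Qed.

Definition chi4 (m : nat) : int :=
  if odd m then if (m %% 4 == 1)%N then 1 else -1 else 0.

Definition chi8 (m : nat) : int :=
  if odd m then if (m %% 8 == 1)%N || (m %% 8 == 7)%N then 1 else -1 else 0.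

(** For a primitive eighth root of unity [z], [z - z ^ 3] is a square root of 2, and its Frobenius
    image depends only on [p] modulo 8. *)
Lemma legendre_2 (p : nat) : prime p -> odd p -> legendre 2 p = chi8 p.
Proof.
move=> p_pr p_odd.
have [|F [z [chF prim_z]]] := @prim_root_coprime_char p 8 p_pr isT.
  by rewrite coprimen8.
have z4 : z ^+ 4 = -1.
  have : (z ^+ 4) ^+ 2 == 1 by rewrite -exprM (prim_expr_order prim_z).
  by rewrite sqrf_eq1 -(prim_order_dvd prim_z) /= => /eqP.
apply: (@gauss_sum_euler F p (z - z ^+ 3)) => //.
- by rewrite /chi8 p_odd; case: ifP; constructor.
- have -> : (z - z ^+ 3) ^+ 2 = z ^+ 2 - 2%:R * z ^+ 4 + z ^+ 2 * z ^+ 4 by ring.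
  by rewrite z4 -pmulrn; ring.
- rewrite -(pFrobenius_autE chF) rmorphB rmorphXn /= pFrobenius_autE.
  rewrite -(prim_expr_mod prim_z p) /chi8 p_odd.
  have : (p %% 8 = 1 \/ p %% 8 = 3 \/ p %% 8 = 5 \/ p %% 8 = 7)%N by lia.
  have e5 : z ^+ 5 = - z by rewrite exprS z4 mulrN1.
  have e7 : z ^+ 7 = - z ^+ 3 by rewrite (exprD z 3 4) z4 mulrN1.
  case=> [->|[->|[->|->]]] /=.
  + by rewrite expr1 mul1r.
  + have -> : z ^+ 3 ^+ 3 = z ^+ 4 * z ^+ 4 * z by ring.
    by rewrite z4 rmorphN1; ring.
  + by rewrite e5 rmorphN1; ring.
  + have -> : z ^+ 7 ^+ 3 = z * (z ^+ 4) ^+ 5 by ring.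
    by rewrite e7 z4 mul1r; ring.
- by rewrite dvdzE /= dvdn_prime2 //; apply: contraL p_odd => /eqP->.
Qed.

Lemma legendre_N1 (p : nat) : prime p -> odd p ->
  legendre (-1) p = chi4 p.
Proof.
move=> p_pr p_odd; have oddp := odd_prime_card p_pr p_odd.
rewrite /chi4 p_odd.
apply: (sign_inj (two_neq0 oddp)); [exact: qchar_cases|by case: ifP; constructor|].
rewrite /legendre qcharE // rmorphN1 card_Fp //.
rewrite -signr_odd; case: ifP => h.
  by have -> : odd p.-1./2 = false by lia.
by have -> : odd p.-1./2 = true by lia.
Qed.

(** * Values of the convolution of a real character with 1 *)

(** The inverse of the product map sends [d] to [(gcdn d m, gcdn d n)]. *)
Lemma perm_divisors_coprime (m n : nat) : (0 < m)%N -> (0 < n)%N -> coprime m n ->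
  perm_eq (divisors (m * n)) [seq (x * y)%N | x <- divisors m, y <- divisors n].
Proof.
move=> m0 n0 mn; have mn0 : (0 < m * n)%N by rewrite muln_gt0 m0.
have gcdE x y : (x %| m)%N -> (y %| n)%N -> gcdn (x * y) m = x /\ gcdn (x * y) n = y.
  move=> xm yn; split.
    by rewrite gcdnC Gauss_gcdl ?(coprime_dvdr yn) // gcdnC; apply/gcdn_idPl.
  have cnx : coprime n x by rewrite coprime_sym (coprime_dvdl xm).
  by rewrite gcdnC Gauss_gcdr // gcdnC; apply/gcdn_idPl.
apply: uniq_perm; first exact: divisors_uniq.
  apply: allpairs_uniq; rewrite ?divisors_uniq //.
  move=> [x y] [x' y'] /allpairsP[[a b] /= [ha hb [-> ->]]] /allpairsP[[c d] /= [hc hd [-> ->]]] h.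
  move: ha hb hc hd; rewrite -!dvdn_divisors // => ha hb hc hd.
  have [e1 e2] := gcdE _ _ ha hb; have [e3 e4] := gcdE _ _ hc hd.
  by congr (_, _); [rewrite -e1 h e3 | rewrite -e2 h e4].
move=> d; rewrite -dvdn_divisors //; apply/idP/allpairsP => [dmn|[[x y] /= [hx hy ->]]].
  exists (gcdn d m, gcdn d n); split; rewrite -?dvdn_divisors ?dvdn_gcdr //=.
  apply/eqP; rewrite eqn_dvd; apply/andP; split; last first.
    rewrite Gauss_dvd ?dvdn_gcdl //.
    exact: coprime_dvdl (dvdn_gcdr _ _) (coprime_dvdr (dvdn_gcdr _ _) mn).
  by rewrite muln_gcdl dvdn_gcd dvdn_mulr //= muln_gcdr dvdn_gcd dvdn_mull.
by move: hx hy; rewrite -!dvdn_divisors // => hx hy; apply: dvdn_mul.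
Qed.

Lemma perm_divisors_pfactor (p v : nat) : prime p ->
  perm_eq (divisors (p ^ v)) [seq (p ^ i)%N | i <- iota 0 v.+1].
Proof.
move=> p_pr; apply: uniq_perm; first exact: divisors_uniq.
  by rewrite map_inj_uniq ?iota_uniq //; apply: expnI; exact: prime_gt1.
move=> d; rewrite -dvdn_divisors ?expn_gt0 ?prime_gt0 //.
apply/dvdn_pfactor/mapP => // -[i].
  by move=> iv ->; exists i; rewrite ?mem_iota.
by rewrite mem_iota => iv ->; exists i.
Qed.

Section RealCharacter.
Variables (Q : nat) (chi : nat -> int).
Hypotheses (Q_gt1 : (1 < Q)%N)
  (chiM : forall x y, chi (x * y) = chi x * chi y)
  (chi_mod : forall x y, x = y %[mod Q] -> chi x = chi y)
  (chi_eq0 : forall x, (chi x == 0) = ~~ coprime x Q)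
  (chi_cases : forall x, ternary_valued (chi x)).

(** The convolution of [chi] with 1, called [rho] in the overview. *)
Definition divisor_sum (m : nat) : int := \sum_(d <- divisors m) chi d.

(** For positive [m] this is the condition for [divisor_sum m] to be positive, by
    [divisor_sum_sign]. *)
Definition chi_norm (m : nat) : bool :=
  all (fun p => (chi p == -1) ==> ~~ odd (logn p m)) (primes m).

Lemma chi_normP m :
  reflect (forall p, prime p -> chi p = -1 -> ~~ odd (logn p m)) (chi_norm m).
Proof.
apply: (iffP allP) => [h p p_pr /eqP hp|h p].
  have [/h|] := boolP (p \in primes m); first by rewrite hp.
  by rewrite -logn_gt0 lt0n negbK => /eqP->.
by rewrite mem_primes => /andP[p_pr _]; apply/implyP => /eqP /(h p p_pr).
Qed.

Lemma chi1 : chi 1 = 1.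
Proof.
have := chiM 1 1; have := chi_eq0 1; rewrite coprime1n mul1n.
by case: (chi_cases 1) => ->.
Qed.

Lemma chiX p i : chi (p ^ i) = chi p ^+ i.
Proof. by elim: i => [|i IH]; rewrite ?expn0 ?chi1 // expnS chiM IH exprS. Qed.

Lemma divisor_sumM m n : (0 < m)%N -> (0 < n)%N -> coprime m n ->
  divisor_sum (m * n) = divisor_sum m * divisor_sum n.
Proof.
move=> m0 n0 mn; rewrite /divisor_sum (perm_big _ (perm_divisors_coprime m0 n0 mn)) /=.
rewrite big_allpairs_dep /= mulr_suml; apply: eq_bigr => x _.
by rewrite mulr_sumr; apply: eq_bigr => y _; rewrite chiM.
Qed.

Lemma divisor_sum_pfactor p v : prime p ->
  divisor_sum (p ^ v) = \sum_(0 <= i < v.+1) chi p ^+ i.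
Proof.
move=> p_pr; rewrite /divisor_sum (perm_big _ (perm_divisors_pfactor v p_pr)) big_map.
by rewrite /index_iota subn0; apply: eq_bigr => i _; rewrite chiX.
Qed.

(** The geometric sum is 1, [v + 1], or an alternating sum equal to 1 for even [v] and to 0 for odd
    [v], as [chi p] is 0, 1 or -1. *)
Lemma divisor_sum_pfactor_sign p v : prime p -> 0 <= divisor_sum (p ^ v) /\
  (0 < divisor_sum (p ^ v)) = ((chi p == -1) ==> ~~ odd v).
Proof.
move=> p_pr; rewrite divisor_sum_pfactor //.
case: (chi_cases p) => ->; elim: v => [|v [IH1 IH2]]; rewrite ?big_nat1 //.
- by rewrite big_nat_recr //= expr0n addr0; split; rewrite // IH2.
- rewrite big_nat_recr //= expr1n; split; first by rewrite addr_ge0.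
  by rewrite ltr_wpDl.
have sumN k : \sum_(0 <= i < k.+1) (-1) ^+ i = (~~ odd k)%:R :> int.
  elim: k => [|k IHk]; first by rewrite big_nat1.
  by rewrite big_nat_recr //= IHk -signr_odd /=; case: odd.
by rewrite sumN; case: odd.
Qed.

Lemma divisor_sum_sign m : (0 < m)%N -> 0 <= divisor_sum m /\ (0 < divisor_sum m) = chi_norm m.
Proof.
elim/ltn_ind: m => m IH m0; have [m1|m1] := eqVneq m 1%N.
  by rewrite m1 /divisor_sum /chi_norm /= big_seq1 chi1.
have p_pr : prime (pdiv m) by rewrite pdiv_prime //; lia.
set p := pdiv m in p_pr *.
have [m' pm'] := pfactor_coprime p_pr m0; move: (logn p m) => v mE.
have v0 : (0 < v)%N.
  rewrite lt0n; apply: contraL (pdiv_dvd m) => /eqP v0.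
  by rewrite -/p -prime_coprime // mE v0 expn0 muln1.
have m'0 : (0 < m')%N by move: m0; rewrite mE muln_gt0 => /andP[].
have pv0 : (0 < p ^ v)%N by rewrite expn_gt0 prime_gt0.
have m'm : (m' < m)%N by rewrite mE ltn_Pmulr // -(expn0 p) ltn_exp2l ?prime_gt1.
have [IH1 IH2] := IH m' m'm m'0.
have [P1 P2] := divisor_sum_pfactor_sign v p_pr.
have cE : divisor_sum m = divisor_sum m' * divisor_sum (p ^ v).
  by rewrite mE divisor_sumM // coprimeXr // coprime_sym.
have -> : chi_norm m = chi_norm m' && ((chi p == -1) ==> ~~ odd v).
  have pm'0 : logn p m' = 0%N by rewrite logn_coprime.
  have logE q : prime q -> logn q m = (logn q m' + (q == p) * v)%N.
    by move=> q_pr; rewrite mE lognM // lognX (logn_prime q p_pr) mulnC.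
  apply/idP/andP => [/chi_normP h|[/chi_normP h /implyP hp]]; last first.
    apply/chi_normP => q q_pr hq; rewrite logE //.
    case: eqVneq hq => [->|_] hq; last by rewrite mul0n addn0 h.
    by rewrite pm'0 mul1n hp ?hq.
  split; last by apply/implyP => /eqP /(h p p_pr); rewrite logE // pm'0 eqxx mul1n.
  apply/chi_normP => q q_pr /(h q q_pr); rewrite logE //.
  by case: eqVneq => [->|_]; rewrite ?pm'0 // mul0n addn0.
rewrite cE; split; first exact: mulr_ge0.
move: IH1; rewrite le_eqVlt => /orP[/eqP h|h].
  by rewrite -IH2 -h mul0r.
by rewrite -IH2 h -P2 pmulr_rgt0.
Qed.

(** From [n] to [n + 1] the quotient grows by 1 exactly when [Q] divides [n + (Q - c)], that is,
    when [n] is congruent to [c]. *)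
Lemma count_residue (n c : nat) : (c < Q)%N ->
  (\sum_(0 <= f < n | (f %% Q)%N == c) 1 = ((n + (Q.-1 - c)) %/ Q))%N.
Proof.
move=> cQ; elim: n => [|n IH].
  by rewrite big_geq // divn_small // add0n; lia.
rewrite big_mkcond big_nat_recr //= -big_mkcond IH addSn divnS; last by lia.
rewrite addnC; congr (_ + _)%N.
have -> : (n + (Q.-1 - c)).+1 = (n + (Q - c))%N by lia.
suff -> : ((n %% Q)%N == c) = (Q %| n + (Q - c))%N by case: (_ %| _)%N.
have := eqn_modDr c (n + (Q - c)) 0 Q; rewrite -addnA subnK; last exact: ltnW.
by rewrite modnDr add0n (modn_small cQ) mod0n => ->.
Qed.

(** Every residue class meets the interval in [(n - m) %/ Q] points or in one more. *)
Lemma count_residue_le (m n c c' : nat) : (c < Q)%N -> (c' < Q)%N ->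
  (\sum_(m <= f < n | (f %% Q)%N == c) 1%N <= (\sum_(m <= f < n | (f %% Q)%N == c') 1%N).+1)%N.
Proof.
move=> cQ c'Q; have [nm|mn] := leqP n m; first by rewrite !big_geq.
have split_sum k : (\sum_(0 <= f < n | (f %% Q)%N == k) 1%N =
    \sum_(0 <= f < m | (f %% Q)%N == k) 1%N + \sum_(m <= f < n | (f %% Q)%N == k) 1%N)%N.
  by rewrite (@big_cat_nat _ _ _ m 0 n) // ltnW.
have countE k : (k < Q)%N -> exists b : bool,
    (\sum_(m <= f < n | (f %% Q)%N == k) 1 = (n - m) %/ Q + b)%N.
  move=> kQ; have := split_sum k; rewrite !count_residue //.
  have -> : (n + (Q.-1 - k) = (m + (Q.-1 - k)) + (n - m))%N by lia.
  rewrite divnD; last by lia.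
  by move=> h; exists (Q <= (m + (Q.-1 - k)) %% Q + (n - m) %% Q)%N; lia.
have [b ->] := countE c cQ; have [b' ->] := countE c' c'Q.
by rewrite -addnS leq_add2l; case: b => //; lia.
Qed.

(** * The hyperbola method for sums over a residue class, up to [Z ^ 2] *)

Section Hyperbola.
Variable Z : nat.
Let X := (Z ^ 2)%N.

Definition on_class (a e f : nat) : bool := (e * f <= X)%N && (e * f == a %[mod Q])%N.

Definition upper_count (a e : nat) : nat :=
  (\sum_(0 <= f < X.+1 | on_class a e f && (e < f)%N) 1)%N.

Lemma upper_count_big a e : (Z < e)%N -> upper_count a e = 0%N.
Proof.
move=> Ze; rewrite /upper_count big1_seq // => f /andP[/andP[/andP[ef _] e_f] _].
by move: ef; rewrite /X leqNgt => /negP[]; nia.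
Qed.

(** As [e] is invertible modulo [Q], the congruence [e * f = a] puts [f] in a single residue
    class. *)
Lemma upper_countE a e : (0 < e)%N -> coprime e Q -> exists2 c, (c < Q)%N &
  upper_count a e = (\sum_(e.+1 <= f < (X %/ e).+1 | (f %% Q)%N == c) 1%N)%N.
Proof.
move=> e0 eQ; have [u uE] : exists u, (u * e = 1 %[mod Q])%N.
  have [u v uv _] := egcdnP Q e0; exists u.
  by rewrite uv (eqP eQ) modnMDl.
exists ((u * a) %% Q)%N; first by rewrite ltn_pmod; lia.
rewrite (big_nat_widenl _ 0) // (@big_nat_widen _ _ _ _ _ X.+1) ?ltnS ?leq_div //.
apply: eq_bigl => f; rewrite /on_class ltnS leq_divRL // [(f * e)%N]mulnC.
have -> : (f %% Q == (u * a) %% Q)%N = (e * f == a %[mod Q])%N.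
  apply/eqP/eqP => h.
    by rewrite -modnMmr h modnMmr mulnA -modnMml [(e * u)%N]mulnC uE modnMml mul1n.
  by rewrite -modnMmr -h modnMmr mulnA -modnMml uE modnMml mul1n.
by case: (_ <= _)%N; case: (_ < _)%N; case: (_ == _); rewrite //= ?andbT.
Qed.

Lemma upper_count_le a b e : (0 < e)%N -> coprime e Q ->
  (upper_count a e <= (upper_count b e).+1)%N.
Proof.
move=> e0 eQ; have [c cQ ->] := upper_countE a e0 eQ.
by have [c' c'Q ->] := upper_countE b e0 eQ; apply: count_residue_le.
Qed.

Definition class_sum (a : nat) : int :=
  \sum_(0 <= e < X.+1) \sum_(0 <= f < X.+1 | on_class a e f) chi e.

Lemma on_class_chi a e f : chi a = 1 -> on_class a e f -> chi f = chi e.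
Proof.
move=> a1 /andP[_ /eqP /chi_mod]; rewrite chiM a1.
by case: (chi_cases e) => ->; case: (chi_cases f) => ->.
Qed.

(* The pairs [(e, f)] with [e > f] contribute as much as those with [e < f],
   since [chi e = chi f] as soon as [chi (e * f) = chi a = 1]. *)
Lemma class_sum_symmetry a : chi a = 1 ->
  class_sum a = 2 * (\sum_(0 <= e < X.+1) chi e * (upper_count a e)%:R)
    + \sum_(0 <= e < X.+1 | on_class a e e) chi e.
Proof.
move=> a1.
pose G (c : rel nat) := \sum_(0 <= e < X.+1) \sum_(0 <= f < X.+1)
  if on_class a e f && c e f then chi e else 0.
have upperE : \sum_(0 <= e < X.+1) chi e * (upper_count a e)%:R = G ltn.
  apply: eq_bigr => e _; rewrite /upper_count natr_sum mulr_sumr big_mkcond.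
  by apply: eq_bigr => f _; rewrite mulr1.
have lowerE : G ltn = G gtn.
  rewrite /G exchange_big_nat /=; apply: eq_bigr => e _; apply: eq_bigr => f _.
  have -> : on_class a f e = on_class a e f by rewrite /on_class mulnC.
  by case: ifP => // /andP[/on_class_chi->].
have diagE : \sum_(0 <= e < X.+1 | on_class a e e) chi e = G eq_op.
  rewrite /G big_mkcond; apply: eq_big_nat => e /andP[_ eX].
  rewrite (eq_bigr (fun f => if f == e then if on_class a e f then chi e else 0 else 0)).
    by rewrite -big_mkcond big_nat1_eq eX.
  by move=> f _; rewrite eq_sym; case: (f == e); case: on_class.
rewrite diagE upperE mulr2n mulrDl mul1r {2}lowerE /class_sum /G -!big_split /=.
apply: eq_bigr => e _; rewrite -!big_split /= big_mkcond /=; apply: eq_bigr => f _.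
by case: on_class => //=; case: ltngtP => _; rewrite ?addr0 ?add0r.
Qed.

Lemma sum_indicator_le : \sum_(0 <= e < X.+1) ((e < Z.+1)%N%:R : int) = Z.+1%:R.
Proof.
have ZX : (Z.+1 <= X.+1)%N by rewrite /X ltnS; nia.
rewrite -natr_sum; congr (_%:R).
have -> : (\sum_(0 <= e < X.+1) (e < Z.+1) = \sum_(0 <= e < X.+1 | e < Z.+1) 1)%N.
  by rewrite [RHS]big_mkcond; apply: eq_bigr => e _; case: ltnP.
by rewrite -(big_nat_widen _ _ _ xpredT) // sum_nat_const_nat subn0 muln1.
Qed.

(** Only [e <= Z] matters. For each such [e] the two upper counts differ by at most 1 and are
    doubled, and the two diagonal terms differ by at most 2: in all [4 * (Z + 1)]. *)
Lemma class_sum_le a b : chi a = 1 -> chi b = 1 ->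
  class_sum b <= class_sum a + (4 * Z.+1)%:R.
Proof.
move=> a1 b1; rewrite !class_sum_symmetry //.
have hS : \sum_(0 <= e < X.+1) chi e * (upper_count b e)%:R <=
          \sum_(0 <= e < X.+1) chi e * (upper_count a e)%:R + Z.+1%:R.
  rewrite -sum_indicator_le -big_split /=; apply: ler_sum => e _.
  have [eZ|Ze] := ltnP e Z.+1; last by rewrite !upper_count_big // !mulr0.
  have [eQ|eQ] := boolP (coprime e Q); last first.
    by have /eqP-> : chi e == 0 by [rewrite chi_eq0]; rewrite !mul0r.
  have e0 : (0 < e)%N.
    by rewrite lt0n; apply: contraL eQ => /eqP->; rewrite /coprime gcd0n; lia.
  have := upper_count_le a b e0 eQ; have := upper_count_le b a e0 eQ.
  by case: (chi_cases e) => ->; lia.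
have hD : \sum_(0 <= e < X.+1 | on_class b e e) chi e <=
          \sum_(0 <= e < X.+1 | on_class a e e) chi e + 2 * Z.+1%:R.
  rewrite -sum_indicator_le mulr_sumr !(big_mkcond (fun e => on_class _ e e)) -big_split /=.
  apply: ler_sum => e _; have [eZ|Ze] := ltnP e Z.+1.
    by case: (chi_cases e) => ->; do 2!case: on_class.
  have eX : (e * e <= X)%N = false by apply/negbTE; rewrite /X; nia.
  by rewrite /on_class eX.
by rewrite natrM; lia.
Qed.

(** Pairs [(e, f)] are grouped by their product [m]. Coprimality of [a] with [Q > 1] keeps [m = 0]
    out of the class. *)
Lemma class_sumE a : coprime a Q ->
  class_sum a = \sum_(0 <= m < X.+1 | (m == a %[mod Q])%N) divisor_sum m.
Proof.
move=> aQ.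
have posQ m : (m == a %[mod Q])%N -> (0 < m)%N.
  move=> /eqP ma; rewrite lt0n; apply: contraL aQ => /eqP m0.
  by rewrite -coprime_modl -ma m0 mod0n /coprime gcd0n; lia.
have convE m : (0 < m)%N -> (m < X.+1)%N -> divisor_sum m =
    \sum_(0 <= e < X.+1) \sum_(0 <= f < X.+1) if m == (e * f)%N then chi e else 0.
  move=> m0 mX; transitivity (\sum_(0 <= e < X.+1 | (e %| m)%N) chi e).
    rewrite /divisor_sum -[RHS]big_filter; apply: perm_big; apply: uniq_perm.
    - exact: divisors_uniq.
    - by rewrite filter_uniq // iota_uniq.
    move=> d; rewrite -dvdn_divisors // mem_filter mem_index_iota /= andbC.
    by case: (boolP (d %| m)%N) => [/(dvdn_leq m0)|]; rewrite ?andbF ?andbT //; lia.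
  rewrite big_mkcond; apply: eq_bigr => e _; case: ifPn => [em|em].
    have e0 := dvdn_gt0 m0 em.
    rewrite (eq_bigr (fun f => if f == (m %/ e)%N then chi e else 0)).
      by rewrite -big_mkcond big_nat1_eq leq0n (leq_ltn_trans (leq_div _ _)).
    by move=> f _; rewrite eqn_div // [(f * e)%N]mulnC [in RHS]eq_sym.
  by rewrite big1 // => f _; case: eqP => // mE; rewrite mE dvdn_mulr in em.
rewrite big_mkcond /=.
transitivity (\sum_(0 <= m < X.+1) \sum_(0 <= e < X.+1) \sum_(0 <= f < X.+1)
    if m == (e * f)%N then if (e * f == a %[mod Q])%N then chi e else 0 else 0); last first.
  apply: eq_big_nat => m /andP[_ mX]; case: ifPn => [ma|ma].
    rewrite convE ?posQ //; apply: eq_bigr => e _; apply: eq_bigr => f _.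
    by case: eqP => // mE; rewrite -mE ma.
  by rewrite big1 // => e _; rewrite big1 // => f _; case: eqP => // <-; rewrite (negPf ma).
rewrite exchange_big_nat /class_sum; apply: eq_bigr => e _.
rewrite exchange_big_nat big_mkcond; apply: eq_bigr => f _ /=.
rewrite -big_mkcond big_nat1_eq leq0n ltnS /on_class.
by case: (_ <= _)%N.
Qed.

End Hyperbola.

(** * Positivity of the convolution on values of [x ^ 2 + n * y ^ 2] *)

Section Values.
Variables (n : nat) (n_gt0 : (0 < n)%N).
Hypothesis chi_N1_form : forall p x y, prime p -> chi p = -1 ->
  (p %| x ^ 2 + n * y ^ 2)%N -> (p %| x)%N && (p %| y)%N.

(** Descent: a prime with [chi p = -1] that divides the value divides [x] and [y], and dividing both
    by [p] lowers the exponent of [p] by 2. *)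
Lemma chi_norm_form x y : (0 < x)%N -> chi_norm (x ^ 2 + n * y ^ 2).
Proof.
move=> x0; apply/chi_normP => p p_pr hp.
move: x0; elim/ltn_ind: x y => x IH y x0.
have [pm|pm] := boolP (p %| x ^ 2 + n * y ^ 2)%N; last by rewrite logn_coprime ?prime_coprime.
have /andP[/dvdnP[x' xE] /dvdnP[y' yE]] := chi_N1_form p_pr hp pm.
have p1 := prime_gt1 p_pr.
have x'0 : (0 < x')%N by move: x0; rewrite xE muln_gt0 => /andP[].
have -> : (x ^ 2 + n * y ^ 2 = (x' ^ 2 + n * y' ^ 2) * p ^ 2)%N by rewrite xE yE; ring.
rewrite lognM; [|by rewrite addn_gt0 expn_gt0 x'0|by rewrite expn_gt0 prime_gt0].
rewrite pfactorK // oddD addbF; apply: IH => //.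
by rewrite xE ltn_Pmulr.
Qed.

(* Otherwise [class_sum a] vanishes for every bound [Z ^ 2], so [class_sum 1] is
   [O(Z)]; but the values [x ^ 2 + n * y ^ 2] with [x = 1] and [y = 0] modulo [Q]
   and [y] bounded are distinct for large [x], and there are too many of them. *)
Theorem exists_chi_norm_residue a : coprime a Q -> chi a = 1 ->
  exists m, [/\ (0 < m)%N, m = a %[mod Q] & chi_norm m].
Proof.
move=> aQ a1.
(* [B] bounds [n * y ^ 2], and [Z] is at least [x + B], so that all values are at most [Z ^ 2].
   Since [J = 4 * Q + 1], the count [D * J] is [4 * Q * D + D], and [D] exceeds the remaining part
   [4 * Q * (B + 1) + 4 * B + 8] of [4 * (Z + 1)]. *)
pose J := (4 * Q).+1; pose B := (n * (Q * J) ^ 2)%N.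
pose D := (J * B.+1 + 9 + 4 * B)%N.
pose Z := (Q * (B.+1 + D) + B).+1; pose X := (Z ^ 2)%N.
pose x i := (Q * (B.+1 + i)).+1; pose y j := (Q * j)%N.
pose F (ij : 'I_D * 'I_J) := (x ij.1 ^ 2 + n * y ij.2 ^ 2)%N.
have yB j : (j < J)%N -> (n * y j ^ 2 <= B)%N.
  by move=> jJ; rewrite leq_mul2l leq_exp2r // leq_mul2l (ltnW jJ) !orbT.
have xB i : (B < x i)%N by rewrite /x ltnS -[B]mul1n leq_mul //; lia.
(* As [n * y ^ 2 <= B < x], the value lies between [x ^ 2] and [(x + 1) ^ 2], so it determines [x],
   and then [y]. *)
have F_inj : injective F.
  have yx i i' j j' : (j < J)%N -> (i < i')%N ->
      (x i ^ 2 + n * y j ^ 2 = x i' ^ 2 + n * y j' ^ 2)%N -> False.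
    move=> jJ ii' eF; have := yB j jJ; have := xB i.
    have : ((x i).+1 ^ 2 <= x i' ^ 2)%N.
      by rewrite leq_exp2r // /x ltnS ltn_mul2l ltn_add2l ii' andbT ltnW.
    by rewrite -addn1 sqrnD; move: eF; clear; lia.
  move=> [i j] [i' j']; rewrite /F /= => eF.
  have ii' : i = i'.
    apply/val_inj => /=; case: (ltngtP i i') => // ii'.
      by case: (yx _ _ _ _ (ltn_ord j) ii' eF).
    by case: (yx _ _ _ _ (ltn_ord j') ii' (esym eF)).
  rewrite ii' in eF *; congr (_, _); apply/val_inj => /=.
  move/eqP: eF; rewrite eqn_add2l eqn_pmul2l // eqn_exp2r // eqn_pmul2l; last by lia.
  by move/eqP.
have FX ij : (F ij < X.+1)%N.
  have := yB _ (ltn_ord ij.2).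
  have : (x ij.1 + B <= Z)%N.
    have := leq_mul2l Q (B.+1 + ij.1) (B.+1 + D).
    by rewrite leq_add2l (ltnW (ltn_ord ij.1)) orbT /x /Z; lia.
  rewrite -leq_sqr sqrnD ltnS /F /X => hZ hB; apply: leq_trans hZ.
  have : (B <= x ij.1 * B)%N by rewrite leq_pmull.
  by move: hB; clear; lia.
have F1 ij : (F ij = 1 %[mod Q])%N.
  have -> : F ij = (((B.+1 + ij.1) * (x ij.1).+1 + n * (Q * ij.2 ^ 2)) * Q + 1)%N.
    by rewrite /F /x /y; ring.
  by rewrite modnMDl.
have Q1 : coprime 1 Q by rewrite coprime1n.
have lower : (D * J)%N%:R <= class_sum Z 1.
  rewrite class_sumE // -/X big_mkord.
  pose S := [set (inord (F ij) : 'I_X.+1) | ij in [set: 'I_D * 'I_J]].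
  have cardS : #|S| = (D * J)%N.
    rewrite card_imset ?cardsT ?card_prod ?card_ord //.
    by move=> u v /(congr1 val) /=; rewrite !inordK // => /F_inj.
  rewrite -cardS -sumr_const big_mkcond [X in _ <= X]big_mkcond; apply: ler_sum => m _.
  case: ifPn => [/imsetP[ij _ ->]|_].
    rewrite inordK // F1 eqxx.
    have F0 : (0 < F ij)%N by rewrite addn_gt0 expn_gt0.
    have [_ hF] := divisor_sum_sign F0.
    by rewrite -gtz0_ge1 hF chi_norm_form.
  (* At the default value [m = 0] the list of divisors is [[:: 1]], so the term is [chi 1 = 1]. *)
  case: ifPn => // _; have [->|m0] := posnP m; first by rewrite /divisor_sum /= big_seq1 chi1.
  by case: (divisor_sum_sign m0).
have upper := class_sum_le Z a1 chi1.
have big_count : (4 * Z.+1 < D * J)%N.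
  have DE : D = (J * B.+1 + 9 + 4 * B)%N by [].
  by rewrite /Z /J in DE *; clearbody D B; move: DE; clear; lia.
have : 0 < class_sum Z a.
  have : (4 * Z.+1)%:R < (D * J)%N%:R :> int by rewrite ltr_nat.
  by move: lower upper; lia.
rewrite class_sumE // => hpos.
have [/existsP[m /andP[ma hm]]|/existsPn hno] :=
    boolP [exists m : 'I_X.+1, (m == a %[mod Q])%N && (0 < divisor_sum m)].
  have m0 : (0 < m)%N.
    rewrite lt0n; apply: contraL aQ => /eqP m0.
    by rewrite -coprime_modl -(eqP ma) m0 mod0n /coprime gcd0n; lia.
  exists m; split=> //; first exact/eqP.
  by rewrite -(divisor_sum_sign m0).2.
move: hpos; rewrite big_mkord ltNge sumr_le0 // => m ma.
by have := hno m; rewrite ma /= -leNgt.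
Qed.

End Values.
End RealCharacter.

(** * The character of a negative discriminant *)

Lemma chi4_mod8 m : chi4 (m %% 8) = chi4 m.
Proof. by rewrite /chi4 modn_dvdm // odd_mod. Qed.

Lemma chi8_mod8 m : chi8 (m %% 8) = chi8 m.
Proof. by rewrite /chi8 modn_mod odd_mod. Qed.

Lemma chi4M m n : chi4 (m * n) = chi4 m * chi4 n.
Proof.
rewrite -chi4_mod8 -modnMm -(chi4_mod8 m) -(chi4_mod8 n) chi4_mod8.
move: (m %% 8)%N (n %% 8)%N (ltn_pmod m (isT : (0 < 8)%N)) (ltn_pmod n (isT : (0 < 8)%N)).
by do 8?[case=> //]; do 8?[case=> //].
Qed.

Lemma chi8M m n : chi8 (m * n) = chi8 m * chi8 n.
Proof.
rewrite -chi8_mod8 -modnMm -(chi8_mod8 m) -(chi8_mod8 n) chi8_mod8.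
move: (m %% 8)%N (n %% 8)%N (ltn_pmod m (isT : (0 < 8)%N)) (ltn_pmod n (isT : (0 < 8)%N)).
by do 8?[case=> //]; do 8?[case=> //].
Qed.

Lemma ternary_valuedM x y :
  ternary_valued x -> ternary_valued y -> ternary_valued (x * y).
Proof.
by case=> ->; case=> ->; rewrite ?mul0r ?mulr0 ?mul1r ?mulr1 ?mulrNN ?mulr1; constructor.
Qed.

Lemma ternary_valuedX x (b : bool) : ternary_valued x -> ternary_valued (x ^+ b).
Proof. by case: b => // _; constructor 2. Qed.

Lemma chi4_ternary m : ternary_valued (chi4 m).
Proof. by rewrite /chi4; do 2?case: ifP => _; constructor. Qed.

Lemma chi8_ternary m : ternary_valued (chi8 m).
Proof. by rewrite /chi8; do 2?case: ifP => _; constructor. Qed.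

(** * Legendre and Jacobi symbols *)

Lemma legendreM p x y : prime p -> odd p ->
  legendre (x * y) p = legendre x p * legendre y p.
Proof. by move=> p_pr p_odd; rewrite /legendre rmorphM qcharM // odd_prime_card. Qed.

Lemma legendre_mod p x y : prime p -> (p %| x - y)%Z -> legendre x p = legendre y p.
Proof.
move=> p_pr; rewrite (dvdz_pcharf (pchar_Fp p_pr)) rmorphB subr_eq0 /legendre.
by move=> /eqP->.
Qed.

Lemma legendre_eq0 p x : prime p -> (legendre x p == 0) = (p %| x)%Z.
Proof.
by move=> p_pr; rewrite /legendre qchar_eq0 -(dvdz_pcharf (pchar_Fp p_pr)).
Qed.

Lemma legendre_ternary p x : ternary_valued (legendre x p).
Proof. exact: qchar_cases. Qed.

Lemma legendre1 p : legendre 1 p = 1.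
Proof. by rewrite /legendre rmorph1 qchar1. Qed.

(** The Jacobi symbol of [x] over the product of [s], which is given by its list of prime factors
    with repetitions. *)
Definition jacobi (s : seq nat) (x : int) : int := \prod_(q <- s) legendre x q.

Definition odd_primes (s : seq nat) : bool := all (fun q => prime q && odd q) s.

Lemma odd_primes_decomp n : odd n -> exists2 s, odd_primes s & n = (\prod_(q <- s) q)%N.
Proof.
elim/ltn_ind: n => n IH n_odd; have [n1|n1] := leqP n 1.
  by exists [::]; rewrite ?big_nil //; lia.
have p_pr := pdiv_prime n1; have := pdiv_dvd n.
set p := pdiv n in p_pr *; move=> /dvdnP[m nE].
have [m_odd p_odd] : odd m /\ odd p by apply/andP; rewrite -oddM -nE.
have [|//|s hs mE] := IH m; first by rewrite nE ltn_Pmulr ?prime_gt1 //; lia.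
by exists (p :: s); rewrite /= ?p_pr ?p_odd // big_cons -mE nE mulnC.
Qed.

Section Jacobi.
Variable s : seq nat.
Hypothesis hs : odd_primes s.
Let n := (\prod_(q <- s) q)%N.

Lemma jacobiM x y : jacobi s (x * y) = jacobi s x * jacobi s y.
Proof.
rewrite /jacobi -big_split /=; apply: eq_big_seq => q /(allP hs) /andP[q_pr q_odd].
exact: legendreM.
Qed.

Lemma jacobi_mod x y : (n %| x - y)%Z -> jacobi s x = jacobi s y.
Proof.
move=> nxy; apply: eq_big_seq => q qs; have /andP[q_pr _] := allP hs _ qs.
apply: legendre_mod => //; apply: dvdz_trans nxy.
by rewrite dvdzE /= /n (big_rem q) //= dvdn_mulr.
Qed.

Lemma jacobi_ternary x : ternary_valued (jacobi s x).
Proof.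
rewrite /jacobi; elim: (s) => [|q t IH]; first by rewrite big_nil; constructor 2.
by rewrite big_cons; apply: ternary_valuedM => //; exact: legendre_ternary.
Qed.

Lemma jacobi_eq0 (m : nat) : (jacobi s m == 0) = ~~ coprime m n.
Proof.
rewrite /jacobi /n; elim: (s) hs => [|q t IH] /=; first by rewrite !big_nil coprimen1.
case/andP=> /andP[q_pr _] ht; rewrite !big_cons mulf_eq0 IH // coprimeMr negb_and.
by rewrite legendre_eq0 // dvdzE /= [coprime m q]coprime_sym (prime_coprime m q_pr) negbK.
Qed.

Lemma jacobi_N1 : jacobi s (-1) = chi4 n.
Proof.
rewrite /jacobi /n; elim: (s) hs => [|q t IH] /=; first by rewrite !big_nil.
case/andP=> /andP[q_pr q_odd] ht; rewrite !big_cons IH // chi4M legendre_N1 //.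
Qed.

Lemma jacobi_2 : jacobi s 2 = chi8 n.
Proof.
rewrite /jacobi /n; elim: (s) hs => [|q t IH] /=; first by rewrite !big_nil.
by case/andP=> /andP[q_pr q_odd] ht; rewrite !big_cons IH // chi8M legendre_2.
Qed.

(** Both sides are multiplicative in [n], because [chi4 n * n] is; each prime factor is handled by
    quadratic reciprocity. *)
Lemma jacobi_reciprocity p : prime p -> odd p -> coprime p n ->
  legendre (chi4 n * n%:Z) p = jacobi s p.
Proof.
move=> p_pr p_odd; rewrite /jacobi /n; elim: (s) hs => [|q t IH] /=.
  by rewrite !big_nil legendre1.
case/andP=> /andP[q_pr q_odd] ht; rewrite !big_cons coprimeMr => /andP[pq pt].
rewrite -IH // chi4M PoszM mulrACA [LHS]legendreM //; congr (_ * _).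
have <- := quadratic_reciprocity p_pr q_pr p_odd q_odd.
  by rewrite legendre_N1 //.
by apply: contraTneq pq => ->; rewrite prime_coprime // dvdnn.
Qed.

(** The character attached to [- D] for [D] as in [DE] below, written in already reciprocated form
    so that its period [8 * n] is visible. The factor [(odd m)%:R] makes it vanish at even [m] also
    when [i] and [j] are false. *)
Definition disc_char (i j : bool) (m : nat) : int :=
  (odd m)%:R * chi4 m ^+ i * chi8 m ^+ j * jacobi s m.

Let Q := (8 * n)%N.

Lemma disc_charM i j x y : disc_char i j (x * y) = disc_char i j x * disc_char i j y.
Proof.
by rewrite /disc_char oddM chi4M chi8M !exprMn PoszM jacobiM -mulnb natrM; ring.
Qed.

Lemma disc_char_mod i j x y : x = y %[mod Q] -> disc_char i j x = disc_char i j y.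
Proof.
move=> xy; have x8 : (x %% 8 = y %% 8)%N.
  by rewrite -(modn_dvdm x (dvdn_mulr n (dvdnn 8))) xy modn_dvdm // dvdn_mulr.
have xn : (x = y %[mod n])%N.
  by rewrite -(modn_dvdm x (dvdn_mull 8 (dvdnn n))) xy modn_dvdm // dvdn_mull.
rewrite /disc_char -(chi4_mod8 x) -(chi8_mod8 x) x8 chi4_mod8 chi8_mod8.
rewrite (@jacobi_mod x y); last by rewrite -eqz_mod_dvd !modz_nat eqz_nat; apply/eqP.
have -> // : odd x = odd y by lia.
Qed.

Lemma disc_char_ternary i j m : ternary_valued (disc_char i j m).
Proof.
do !apply: ternary_valuedM; try apply: ternary_valuedX.
- by case: odd; [constructor 2 | constructor 1].
- exact: chi4_ternary.
- exact: chi8_ternary.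
- exact: jacobi_ternary.
Qed.

Lemma disc_char_eq0 i j m : (disc_char i j m == 0) = ~~ coprime m Q.
Proof.
rewrite /disc_char !mulf_eq0 jacobi_eq0 coprimeMr negb_and coprimen8.
have [m_odd|//] := boolP (odd m); congr (_ || _).
by case: i j => [] [] //=; rewrite /chi4 /chi8 m_odd; do 2?case: ifP.
Qed.

Lemma disc_char_legendre i j p : prime p -> coprime p Q ->
  disc_char i j p = legendre ((-1) ^+ i * 2 ^+ j * chi4 n * n%:Z) p.
Proof.
move=> p_pr; rewrite coprimeMr coprimen8.
move=> /andP[p_odd pn]; rewrite /disc_char p_odd mul1r -jacobi_reciprocity //.
rewrite -[in RHS]mulrA [RHS]legendreM // [X in _ = X * _]legendreM //; congr (_ * _ * _).
  by case: i; rewrite ?legendre1 // legendre_N1 //.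
by case: j; rewrite ?legendre1 // legendre_2.
Qed.

Variables (i j : bool) (D : nat).
Hypothesis DE : - D%:Z = (-1) ^+ i * 2 ^+ j * chi4 n * n%:Z.

(** Here [- D] is a nonzero square [y ^ 2] modulo [p], and the inverse of [y] serves as [be]. *)
Lemma disc_char_eq1 p : prime p -> disc_char i j p = 1 ->
  exists be : nat, (p %| D * be ^ 2 + 1)%N.
Proof.
move=> p_pr hp.
have pQ : coprime p Q by rewrite -[coprime _ _]negbK -(disc_char_eq0 i j) hp.
have p_odd : odd p by move: pQ; rewrite coprimeMr coprimen8 => /andP[].
have := hp; rewrite disc_char_legendre // -DE /legendre => /eqP.
move=> /(qchar_eq1P (odd_prime_card p_pr p_odd))[y y0 Dy].
exists (y^-1 : 'F_p); rewrite (dvdn_pcharf (pchar_Fp p_pr)) natrD natrM natrX natr_Zp.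
move: Dy; rewrite rmorphN /= -pmulrn => /eqP; rewrite eqr_oppLR => /eqP->.
by rewrite exprVn mulNr mulfV ?addNr // expf_neq0.
Qed.

(** If [p] did not divide [y], then [- D] would be the square of [x / y] modulo [p], of character 0
    or 1. *)
Lemma disc_char_eqN1 p x y : prime p -> disc_char i j p = -1 ->
  (p %| x ^ 2 + D * y ^ 2)%N -> (p %| x)%N && (p %| y)%N.
Proof.
move=> p_pr hp hxy.
have pQ : coprime p Q by rewrite -[coprime _ _]negbK -(disc_char_eq0 i j) hp.
have p_odd : odd p by move: pQ; rewrite coprimeMr coprimen8 => /andP[].
have oddp := odd_prime_card p_pr p_odd.
have [py|py] := boolP (p %| y)%N; rewrite ?andbT ?andbF.
  move: hxy; rewrite dvdn_addl; first by rewrite Euclid_dvdX // andbT.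
  by rewrite dvdn_mull // Euclid_dvdX // py.
have y0 : (y%:R : 'F_p) != 0 by rewrite -(dvdn_pcharf (pchar_Fp p_pr)).
have x2 : (x%:R : 'F_p) ^+ 2 = (- D%:Z)%:~R * y%:R ^+ 2.
  move: hxy; rewrite (dvdn_pcharf (pchar_Fp p_pr)) natrD natrM !natrX addr_eq0 => /eqP->.
  by rewrite rmorphN /= -pmulrn mulNr.
have := disc_char_legendre i j p_pr pQ; rewrite hp -DE /legendre.
have -> : ((- D%:Z)%:~R : 'F_p) = (x%:R / y%:R) ^+ 2.
  by rewrite exprMn exprVn x2 mulfK // expf_neq0.
have x0 : (x%:R : 'F_p) != 0.
  apply/eqP => x0; have := disc_char_legendre i j p_pr pQ; rewrite hp -DE /legendre.
  have /eqP : ((- D%:Z)%:~R : 'F_p) * y%:R ^+ 2 = 0 by rewrite -x2 x0 expr0n.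
  by rewrite mulf_eq0 expf_eq0 (negPf y0) andbF orbF => /eqP->; rewrite qchar0.
by rewrite expr2 qcharM // -expr2 qchar_sqr // mulf_neq0 ?invr_neq0.
Qed.

End Jacobi.

(** Prime by prime: a factor [p ^ 2] goes into [k], while a prime dividing [M] only once goes into
    [m], the Chinese remainder theorem merging the two values of [be]. *)
Lemma square_part_residue (D M : nat) : (0 < M)%N ->
  (forall p, prime p -> odd (logn p M) -> exists be : nat, (p %| D * be ^ 2 + 1)%N) ->
  exists k m be : nat, M = (m * k ^ 2)%N /\ (m %| D * be ^ 2 + 1)%N.
Proof.
elim/ltn_ind: M => M IH M0 hM; have [M1|M1] := leqP M 1.
  by exists 1%N, 1%N, 0%N; rewrite dvd1n; split=> //; lia.
have p_pr := pdiv_prime M1; have := pdiv_dvd M; set p := pdiv M in p_pr *.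
move=> /dvdnP[M' ME].
have M'0 : (0 < M')%N by move: M0; rewrite ME muln_gt0 => /andP[].
have p_gt1 := prime_gt1 p_pr.
have M'M : (M' < M)%N by rewrite ME ltn_Pmulr.
have [/dvdnP[M2 M'E]|pM'] := boolP (p %| M')%N.
  have M2_0 : (0 < M2)%N by move: M'0; rewrite M'E muln_gt0 => /andP[].
  have ME2 : M = (M2 * p ^ 2)%N by rewrite ME M'E; ring.
  have [||q q_pr hq|k [m [be [M2E hm]]]] := IH M2 => //.
  - by apply: leq_ltn_trans M'M; rewrite M'E leq_pmulr // ltnW.
  - apply: hM => //; rewrite ME2 lognM ?expn_gt0 ?(ltnW p_gt1) //.
    by rewrite lognX oddD oddM addbF.
  by exists (k * p)%N, m, be; split=> //; rewrite ME2 M2E; ring.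
have logE q : prime q -> logn q M = (logn q M' + (q == p))%N.
  by move=> q_pr; rewrite ME lognM ?(ltnW p_gt1) // (logn_prime q p_pr).
have pM'0 : logn p M' = 0%N by rewrite logn_coprime // prime_coprime.
have [be1 hbe1] : exists be : nat, (p %| D * be ^ 2 + 1)%N.
  by apply: hM => //; rewrite logE // pM'0 eqxx.
have [|k [m [be2 [M'E hm]]]] := IH M' M'M M'0.
  move=> q q_pr hq; apply: hM => //; rewrite logE // oddD hq.
  by case: eqVneq hq => [->|//]; rewrite pM'0.
have cpm : coprime p m.
  by rewrite prime_coprime //; apply: contra pM'; rewrite M'E => /dvdn_mulr->.
exists k, (p * m)%N, (chinese p m be1 be2); split; first by rewrite ME M'E; ring.
rewrite Gauss_dvd //; apply/andP; split.
  rewrite /dvdn -modnDml -modnMmr -modnXm chinese_modl // modnXm modnMmr modnDml.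
  exact: hbe1.
rewrite /dvdn -modnDml -modnMmr -modnXm chinese_modr // modnXm modnMmr modnDml.
exact: hm.
Qed.

(** * The three-square theorem *)

Definition three_squares (n : int) : Prop :=
  exists x y z : int, n = x ^+ 2 + y ^+ 2 + z ^+ 2.

(** The number [M] found by the averaging argument is coprime to the modulus, so a prime of odd
    exponent in it has character neither 0 nor -1, hence 1; the square part of [M] is then split
    off. *)
Lemma exists_residue_modulus (s : seq nat) (i j : bool) (D a : nat) :
  let n := (\prod_(q <- s) q)%N in
  (0 < D)%N -> odd_primes s -> - D%:Z = (-1) ^+ i * 2 ^+ j * chi4 n * n%:Z ->
  disc_char s i j a = 1 ->
  exists k m be : nat, [/\ (0 < m)%N, m * k ^ 2 = a %[mod 8 * n] & (m %| D * be ^ 2 + 1)%N].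
Proof.
move=> n D0 hs DE a1.
have aQ : coprime a (8 * n) by rewrite -[coprime _ _]negbK -(disc_char_eq0 hs i j) a1.
have n0 : (0 < n)%N by rewrite /n big_seq prodn_cond_gt0 // => q /(allP hs)/andP[/prime_gt0].
have [|||M [M0 Ma hM]] := @exists_chi_norm_residue (8 * n)%N (disc_char s i j) _
    (disc_charM hs i j) (@disc_char_mod s hs i j) (@disc_char_eq0 s hs i j)
    (@disc_char_ternary s i j) D _ _ a aQ a1 => //; first by lia.
  by move=> p x y; apply: disc_char_eqN1.
have MQ : coprime M (8 * n) by rewrite -coprime_modl Ma coprime_modl.
have [|k [m [be [ME hm]]]] := @square_part_residue D M M0.
  move=> p p_pr p_odd; apply: (disc_char_eq1 hs DE p_pr).
  have pM : (p %| M)%N by apply: contraTT p_odd => pM; rewrite logn_coprime ?prime_coprime.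
  have := disc_char_eq0 hs i j p; rewrite (coprime_dvdl pM MQ).
  case: (disc_char_ternary s i j p) => [->//|//|hp].
  by have /chi_normP/(_ p p_pr hp) := hM; rewrite p_odd.
exists k, m, be; split=> //; last by rewrite -ME.
by move: M0; rewrite ME muln_gt0 => /andP[].
Qed.

Lemma three_squares_of_nat (n m al be : nat) : (0 < n)%N -> (0 < m)%N ->
  (n %| m * al ^ 2 + 1)%N -> (m %| n * be ^ 2 + 1)%N -> three_squares n%:Z.
Proof.
by move=> n0 m0 h1 h2; apply: (@three_squares_of_residues n m al be).
Qed.

Lemma jacobi_of_N1 (s : seq nat) (a : nat) : odd_primes s ->
  (\prod_(q <- s) q %| a.+1)%N -> jacobi s a = chi4 (\prod_(q <- s) q).
Proof.
by move=> hs ha; rewrite -jacobi_N1 //; apply: jacobi_mod => //; rewrite opprK addrC.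
Qed.

Lemma exists_residue8 (n b : nat) (c : nat) : odd n ->
  exists a, (a %% 8 = c %% 8)%N /\ (a = b %[mod n])%N.
Proof.
move=> n_odd; have c8 : coprime 8 n by rewrite coprime_sym coprimen8.
by exists (chinese 8 n c b); rewrite chinese_modl // chinese_modr.
Qed.

Lemma dvdn_add1_mod (n a b : nat) : (a = b %[mod n])%N -> (n %| a.+1)%N = (n %| b.+1)%N.
Proof. by move=> ab; rewrite /dvdn -(addn1 a) -(addn1 b) -modnDml ab modnDml. Qed.

Lemma eq_mod_mul d e x y : (x = y %[mod d * e])%N ->
  (x = y %[mod d])%N /\ (x = y %[mod e])%N.
Proof.
move=> xy; have de : (d %| d * e)%N by apply: dvdn_mulr.
have ed : (e %| d * e)%N by apply: dvdn_mull.
by split; [rewrite -(modn_dvdm x de) xy modn_dvdm | rewrite -(modn_dvdm x ed) xy modn_dvdm].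
Qed.

Lemma chi4E m : odd m -> chi4 m = if (m %% 4 == 1)%N then 1 else -1.
Proof. by rewrite /chi4 => ->. Qed.

Lemma chi8E m : odd m -> chi8 m = if (m %% 8 == 1)%N || (m %% 8 == 7)%N then 1 else -1.
Proof. by rewrite /chi8 => ->. Qed.

(** The residue [a] is -1 modulo [n] and 1 modulo 8. Its character is the symbol of -1 over [n],
    which is 1, and [k] serves as [al]. *)
Theorem three_squares_1mod4 (n : nat) : (n %% 4 = 1)%N -> three_squares n%:Z.
Proof.
move=> n4; have n_odd : odd n by lia.
have n0 : (0 < n)%N by lia.
have [s hs nE] := odd_primes_decomp n_odd.
have [a [a8 an]] := exists_residue8 n.-1 1 n_odd.
have a_odd : odd a by lia.
have na : (n %| a.+1)%N by rewrite (dvdn_add1_mod an) prednK //; lia.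
have c4 : chi4 n = 1 by rewrite chi4E // n4.
have [|||k [m [be [m0 mk hm]]]] := @exists_residue_modulus s true false n a _ hs.
- by lia.
- by rewrite -nE c4 expr1 expr0 !mulr1 mulN1r.
- rewrite /disc_char a_odd (jacobi_of_N1 hs) -?nE // c4 chi4E //.
  by have -> : (a %% 4 = 1)%N by lia.
apply: (@three_squares_of_nat n m k be n0 m0 _ hm).
have [_ mkn] := eq_mod_mul mk; rewrite -nE in mkn.
by rewrite addn1 (dvdn_add1_mod mkn).
Qed.

(** The symbol of -1 over [n] is now -1, so [2 * m] takes the place of [m]: [a] is -1/2 modulo [n],
    of symbol [(-1) * (-1) = 1]. *)
Theorem three_squares_3mod8 (n : nat) : (n %% 8 = 3)%N -> three_squares n%:Z.
Proof.
move=> n8; have n_odd : odd n by lia.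
have n0 : (0 < n)%N by lia.
have [s hs nE] := odd_primes_decomp n_odd.
have [a [a8 an]] := exists_residue8 n./2 1 n_odd.
have a_odd : odd a by lia.
have na : (n %| (2 * a).+1)%N.
  rewrite (@dvdn_add1_mod _ _ (2 * n./2)); last by rewrite -modnMmr an modnMmr.
  by have -> : ((2 * n./2).+1 = n)%N by lia.
have c4 : chi4 n = -1 by rewrite chi4E //; have -> : (n %% 4 = 3)%N by lia.
have e2 : chi8 n = -1 by rewrite chi8E // n8.
have ja : jacobi s a = 1.
  have := jacobi_of_N1 hs (a := 2 * a); rewrite -nE c4 PoszM jacobiM // jacobi_2 // -nE e2.
  by move=> /(_ na); lia.
have [|||k [m [be [m0 mk hm]]]] := @exists_residue_modulus s false false n a _ hs.
- by lia.
- by rewrite -nE c4 !expr0 !mul1r mulN1r.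
- by rewrite /disc_char a_odd ja.
have [e8 mkn] := eq_mod_mul mk; rewrite -nE in mkn.
have m_odd : odd m.
  have : odd (m * k ^ 2)%N.
    by move: e8 a_odd; clear; lia.
  by rewrite oddM => /andP[].
(* Adding the odd number [m] if necessary makes [be] odd, so that [n * be ^ 2 + 1] is divisible by 2
   as well as by [m]. *)
pose be' := (be + ~~ odd be * m)%N.
have be'_odd : odd be' by rewrite /be' oddD oddM oddb m_odd andbT; case: (odd be).
have beE : (be' = be %[mod m])%N by rewrite /be' addnC modnMDl.
have hm' : (m %| n * be' ^ 2 + 1)%N.
  by rewrite /dvdn -modnDml -modnMmr -modnXm beE modnXm modnMmr modnDml.
apply: (@three_squares_of_nat n (2 * m) k be' n0); first by rewrite muln_gt0.
  have mkn2 : (2 * m * k ^ 2 = 2 * a %[mod n])%N.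
    by rewrite -mulnA -modnMmr mkn modnMmr.
  by rewrite addn1 (dvdn_add1_mod mkn2).
rewrite Gauss_dvd ?coprime2n // hm' andbT dvdn2.
by rewrite oddD oddM oddX n_odd be'_odd.
Qed.

Theorem three_squares_2mod4 (n : nat) : (n %% 4 = 2)%N -> three_squares n%:Z.
Proof.
move=> n4; have n0 : (0 < n)%N by lia.
pose h := n./2; have h_odd : odd h by rewrite /h; lia.
have nE2 : n = (2 * h)%N by rewrite /h; lia.
have [s hs hE] := odd_primes_decomp h_odd.
(* The residue [a] is -1 modulo [h] and [c] modulo 8, where [c] is picked to give it character 1.
   The factor 2 of [n] divides [m * k ^ 2 + 1] because [a] is odd. *)
have key (i : bool) c : (c %% 2 = 1)%N -> - n%:Z = (-1) ^+ i * 2 * chi4 h * h%:Z ->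
    chi4 c ^+ i * chi8 c * chi4 h = 1 -> three_squares n%:Z.
  move=> c2 nE cE; have [a [a8 ah]] := exists_residue8 h.-1 c h_odd.
  have a_odd : odd a by lia.
  have ha : (h %| a.+1)%N by rewrite (dvdn_add1_mod ah) prednK //; lia.
  have [|||k [m [be [m0 mk hm]]]] := @exists_residue_modulus s i true n a _ hs.
  - by lia.
  - by rewrite -hE nE expr1.
  - rewrite /disc_char a_odd (jacobi_of_N1 hs) -?hE //.
    by rewrite -(chi4_mod8 a) -(chi8_mod8 a) a8 chi4_mod8 chi8_mod8 mul1r.
  apply: (@three_squares_of_nat n m k be n0 m0 _ hm).
  rewrite nE2 Gauss_dvd ?coprime2n // addn1.
  have [mk8 mkh] := eq_mod_mul mk; rewrite -hE in mkh.
  rewrite (dvdn_add1_mod mkh) ha andbT dvdn2.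
  by rewrite /= negbK; move: mk8 a_odd; clear; lia.
have [h4|h4] : (h %% 4 = 1 \/ h %% 4 = 3)%N by lia.
  have c4 : chi4 h = 1 by rewrite chi4E // h4.
  by apply: (key true 1%N); rewrite ?c4 ?expr1 ?nE2 //; lia.
have c4 : chi4 h = -1 by rewrite chi4E // h4.
by apply: (key false 3%N); rewrite ?c4 ?expr0 ?nE2 //; lia.
Qed.

Theorem three_squares_theorem (n : nat) :
  (n %% 4 != 0)%N -> (n %% 8 != 7)%N -> three_squares n%:Z.
Proof.
move=> n4 n8; have [h|[h|h]] : (n %% 4 = 1 \/ n %% 4 = 2 \/ n %% 8 = 3)%N by lia.
- exact: three_squares_1mod4.
- exact: three_squares_2mod4.
- exact: three_squares_3mod8.
Qed.

(** * Adding a power *)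

Lemma three_squares_scale (c n : int) : three_squares n -> three_squares (c ^+ 2 * n).
Proof.
by case=> x [y [z ->]]; exists (c * x), (c * y), (c * z); ring.
Qed.

Definition power_plus_three_squares (l m M : nat) : Prop :=
  exists r : nat, three_squares (M%:Z - (l%:Z * r%:Z ^+ m) ^+ 2).

(** Doubling [r] multiplies [(l * r ^ m) ^ 2] by [4 ^ m], which is a square. *)
Lemma power_plus_scale l m M : power_plus_three_squares l m M ->
  power_plus_three_squares l m (2 ^ m * (2 ^ m * M)).
Proof.
case=> r h; exists (2 * r)%N.
have -> : (2 ^ m * (2 ^ m * M))%N%:Z - (l%:Z * (2 * r)%N%:Z ^+ m) ^+ 2 =
    (2 ^+ m) ^+ 2 * (M%:Z - (l%:Z * r%:Z ^+ m) ^+ 2).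
  have -> : (2 ^ m * (2 ^ m * M))%N%:Z = 2 ^+ m * (2 ^+ m * M%:Z).
    by rewrite !PoszM -[(2 ^ m)%N%:Z]natz natrX.
  by rewrite PoszM [(_ * r%:Z) ^+ m]exprMn; ring.
exact: three_squares_scale.
Qed.

(* The choice of [r] is forced modulo a power of 2 by the condition that
   [M - (l * r ^ m) ^ 2] should not be of the form [4 ^ k * (8 * u + 7)]. *)
Lemma power_plus_reduced l m M : l = 1%N \/ l = 2%N -> m = 2%N \/ m = 3%N ->
  ~~ (2 ^ (2 * m) %| M)%N -> power_plus_three_squares l m M.
Proof.
move=> hl hm hM.
have base u c : (u %% 4 != 0)%N -> (u %% 8 != 7)%N -> power_plus_three_squares l m (c ^ 2 * u).
  move=> u4 u8; exists 0%N; have -> : (0%:Z ^+ m = 0) by case: hm => ->.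
  rewrite mulr0 expr0n subr0 PoszM -[(c ^ 2)%N%:Z]natz natrX natz.
  exact/three_squares_scale/three_squares_theorem.
have step r c v M' : (M' = c ^ 2 * v + (l * r ^ m) ^ 2)%N ->
    (v %% 4 != 0)%N -> (v %% 8 != 7)%N -> power_plus_three_squares l m M'.
  move=> -> v4 v8; exists r.
  have -> : (c ^ 2 * v + (l * r ^ m) ^ 2)%N%:Z - (l%:Z * r%:Z ^+ m) ^+ 2 = c%:Z ^+ 2 * v%:Z.
    rewrite PoszD PoszM -[(c ^ 2)%N%:Z]natz -[((l * r ^ m) ^ 2)%N%:Z]natz !natrX natrM natrX !natz.
    by ring.
  exact/three_squares_scale/three_squares_theorem.
have [u [k [u4 km ME]]] : exists u k, [/\ (u %% 4 != 0)%N, (k < m)%N & M = ((2 ^ k) ^ 2 * u)%N].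
  have [h0|h0] := boolP (4 %| M)%N; last by exists M, 0%N; split=> //; [case: hm => -> | lia].
  have [h1|h1] := boolP (4 %| M %/ 4)%N.
    exists (M %/ 4 %/ 4)%N, 2%N; case: hm hM => -> hM; split=> //; lia.
  by exists (M %/ 4)%N, 1%N; split=> //; [case: hm => -> | lia].
have [u8|u8] := eqVneq (u %% 8)%N 7; last by rewrite ME; apply: base.
have [k0|[k1|k2]] : k = 0%N \/ k = 1%N \/ (k = 2%N /\ m = 3%N) by lia.
(* The arguments of [step] are [r], [c] and [v]. Since [u] is 7 modulo 8, [u - 1] is 6 and both
   [u - 4] and [4 * u - 1] are 3 modulo 8. *)
- by case: hl => hl; [apply: (step 1%N 1%N (u - 1)%N) | apply: (step 1%N 1%N (u - 4)%N)];
    rewrite ?ME ?hl ?k0 ?exp1n; lia.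
- by case: hl => hl; [apply: (step 1%N 1%N (4 * u - 1)%N) | apply: (step 1%N 2%N (u - 1)%N)];
    rewrite ?ME ?hl ?k1 ?exp1n; lia.
by case: k2 => k2 m3; case: hl => hl;
  [apply: (step 2%N 4%N (u - 4)%N) | apply: (step 1%N 2%N (4 * u - 1)%N)];
  rewrite ?ME ?hl ?k2 ?m3 ?exp1n; lia.
Qed.

Theorem power_plus_three_squaresP l m M : l = 1%N \/ l = 2%N -> m = 2%N \/ m = 3%N ->
  power_plus_three_squares l m M.
Proof.
move=> hl hm; elim/ltn_ind: M => M IH; have [->|M0] := posnP M.
  by exists 0%N, 0, 0, 0; case: hm => ->; rewrite !expr0n mulr0.
have [/dvdnP[M' ME]|hM] := boolP (2 ^ (2 * m) %| M)%N; last exact: power_plus_reduced.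
have -> : M = (2 ^ m * (2 ^ m * M'))%N by rewrite ME mulnA -expnD addnn -mul2n mulnC.
apply/power_plus_scale/IH.
move: M0; rewrite ME muln_gt0 => /andP[M'0 _]; rewrite ltn_Pmulr //.
by case: hm => ->.
Qed.

(* [x, y, z, w] are the coordinates of the quaternion [q * u / N], where
   [q = (a, b, c, d)] and [u = (t, s1, s2, s3)] has norm [N * n]. *)
Theorem theorem1p4 (a b c d : int) (lambda m : nat)
    (habcd : ~ (a = 0 /\ b = 0 /\ c = 0 /\ d = 0))
    (hlambda : lambda = 1%N \/ lambda = 2%N)
    (hm : m = 2%N \/ m = 3%N) :
  let N : int := a ^+ 2 + b ^+ 2 + c ^+ 2 + d ^+ 2 in
  forall n : nat,
  exists x y z w : rat,
    [/\ (n%:R : rat) = x ^+ 2 + y ^+ 2 + z ^+ 2 + w ^+ 2,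
        [/\ N%:~R * x \is a Num.int, N%:~R * y \is a Num.int,
            N%:~R * z \is a Num.int & N%:~R * w \is a Num.int]
      & exists r : nat,
          a%:~R * x + b%:~R * y + c%:~R * z + d%:~R * w
            = lambda%:R * r%:R ^+ m].

Proof.
move=> N n.
have N_ge0 : 0 <= N by rewrite !addr_ge0 ?sqr_ge0.
have N0 : N != 0.
  apply/eqP => N0; apply: habcd; move: N0; rewrite /N => N0.
  have := sqr_ge0 a; have := sqr_ge0 b; have := sqr_ge0 c; have := sqr_ge0 d.
  move=> hd hc hb ha.
  have sq0 (x : int) : x ^+ 2 = 0 -> x = 0 by move=> /eqP; rewrite sqrf_eq0 => /eqP.
  by split; [|split; [|split]]; apply: sq0; lia.
have [r [s1 [s2 [s3 hs]]]] := power_plus_three_squaresP (absz N * n)%N hlambda hm.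
pose t := lambda%:Z * r%:Z ^+ m; rewrite -/t PoszM gez0_abs // in hs.
pose X := a * t - b * s1 - c * s2 - d * s3.
pose Y := a * s1 + b * t + c * s3 - d * s2.
pose U := a * s2 - b * s3 + c * t + d * s1.
pose V := a * s3 + b * s2 - c * s1 + d * t.
have NQ : N%:~R != 0 :> rat by rewrite intr_eq0.
(* Euler's four-square identity: the norm of [q * u] is [N] times the norm [N * n] of [u]. *)
have normE : N ^+ 2 * n%:Z = X ^+ 2 + Y ^+ 2 + U ^+ 2 + V ^+ 2.
  have -> : N ^+ 2 * n%:Z = N * ((N * n%:Z - t ^+ 2) + t ^+ 2) by ring.
  by rewrite hs /N /X /Y /U /V; ring.
(* The inner product of [q] with [q * u] is the real part of [conj(q) * q * u = N * u]. *)
have dotE : a * X + b * Y + c * U + d * V = N * t by rewrite /N /X /Y /U /V; ring.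
exists (X%:~R / N%:~R), (Y%:~R / N%:~R), (U%:~R / N%:~R), (V%:~R / N%:~R); split.
- have h : N%:~R ^+ 2 * n%:R = X%:~R ^+ 2 + Y%:~R ^+ 2 + U%:~R ^+ 2 + V%:~R ^+ 2 :> rat.
    by rewrite pmulrn -!rmorphXn -rmorphM -!rmorphD normE.
  by apply: (mulfI (expf_neq0 2 NQ)); rewrite h; field.
- by split; rewrite mulrC divfK // intr_int.
exists r.
have h : a%:~R * X%:~R + b%:~R * Y%:~R + c%:~R * U%:~R + d%:~R * V%:~R
    = N%:~R * (lambda%:R * r%:R ^+ m) :> rat.
  by rewrite !pmulrn -rmorphXn -!rmorphM -!rmorphD dotE.
by apply: (mulfI NQ); rewrite -h; field.
Qed.
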